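(* Let $\mathbb{K}$ be a field of characteristic zero that contains all roots of $1$. Let $S$ be a non-trivial Severi--Brauer surface over $\mathbb{K}$, and let $G\subset\mathrm{Aut}(S)$ be a finite subgroup. Then $G$ is isomorphic to a subgroup of $\boldsymbol{\mu}_3^2$.
   Context: A Severi--Brauer surface over a field $\mathbb{K}$ is a (projective) surface over $\mathbb{K}$ that becomes isomorphic to $\mathbb{P}^2$ over the algebraic closure of $\mathbb{K}$. It is called non-trivial if it is not isomorphic to $\mathbb{P}^2$ over $\mathbb{K}$. $\mathrm{Aut}(S)$ is the group of automorphisms of $S$ over $\mathbb{K}$. $\boldsymbol{\mu}_n$ denotes the cyclic group of order $n$. *)

(* Defs.v *)
From HB Require Import structures.
From mathcomp Require Import all_boot all_order all_algebra all_fingroup.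
From mathcomp Require Export mpoly.

Set Implicit Arguments.
Unset Strict Implicit.
Unset Printing Implicit Defensive.

Import GRing.Theory.

Local Open Scope ring_scope.

(* Projective varieties over a perfect field k are taken in the classical
   sense: Zariski closed subsets of P^n(L), L an algebraically closed extension
   of k, cut out by homogeneous polynomials over k; morphisms over k are the
   maps on L-points that are, Zariski locally, given by homogeneous polynomials
   over k.  Every notion below depends on the embedding j : k -> L; with
   j = idfun one gets varieties and morphisms over L itself. *)

(* P^n(L): lines through the origin in L^(n+1). *)
Definition pspace (L : fieldType) (n : nat) :=
  {U : {vspace 'rV[L]_n.+1} | \dim U == 1}.

(* A choice of homogeneous coordinates (a nonzero vector of the line). *)
Definition hcoord (L : fieldType) (n : nat) (x : pspace L n) : 'rV[L]_n.+1 :=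
  vpick (val x).

(* When p is homogeneous, whether [peval j p (hcoord x)] is zero does not
   depend on the choice made in [hcoord]. *)
Definition peval (k L : fieldType) (j : {rmorphism k -> L}) (n : nat)
    (p : {mpoly k[n.+1]}) (v : 'rV[L]_n.+1) : L :=
  (map_mpoly j p).@[fun i => v 0 i].

Record projvar (k : fieldType) := Projvar {
  pv_dim : nat;                            (* of the ambient space *)
  pv_eqs : seq {mpoly k[pv_dim.+1]};
  pv_homog : all (fun p => p \is homog mdeg) pv_eqs }.

Definition pn (k : fieldType) (n : nat) : projvar k :=
  @Projvar k n [::] isT.

Lemma map_homog (k L : fieldType) (j : {rmorphism k -> L}) (n : nat)
    (s : seq {mpoly k[n.+1]}) :
  all (fun p => p \is homog mdeg) s ->
  all (fun p => p \is homog mdeg) (map (map_mpoly j) s).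
Proof.
move=> /allP hs; rewrite all_map; apply/allP => p /hs /homogP[d /dhomogP hp].
apply/homogP; exists d; apply/dhomogP => m.
by rewrite (perm_mem (msupp_map_mpoly p (fmorph_inj j))) => /hp.
Qed.

Definition base_change (k L : fieldType) (j : {rmorphism k -> L})
    (X : projvar k) : projvar L :=
  Projvar (map_homog j (pv_homog X)).

Definition gpoint (k L : fieldType) (j : {rmorphism k -> L}) (X : projvar k) :=
  {x : pspace L (pv_dim X) |
    all (fun p => peval j p (hcoord x) == 0) (pv_eqs X)}.

(* f is a morphism over k: every point x has a principal open neighbourhood
   {h != 0}, defined over k, on which f is [F_0 : ... : F_m] for forms F_i over
   k of the same degree without common zero there. *)
Definition regular (k L : fieldType) (j : {rmorphism k -> L})
    (X Y : projvar k) (f : gpoint j X -> gpoint j Y) : Prop :=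
  forall x : gpoint j X,
  exists (e d : nat) (h : {mpoly k[(pv_dim X).+1]})
         (F : 'I_(pv_dim Y).+1 -> {mpoly k[(pv_dim X).+1]}),
  [/\ h \is e.-homog, forall i, F i \is d.-homog,
      peval j h (hcoord (val x)) != 0
    & forall y : gpoint j X, peval j h (hcoord (val y)) != 0 ->
        let w := \row_i peval j (F i) (hcoord (val y)) in
        w != 0 /\ val (val (f y)) = <[w]>%VS].

Definition isomorphism (k L : fieldType) (j : {rmorphism k -> L})
    (X Y : projvar k) (f : gpoint j X -> gpoint j Y) : Prop :=
  regular f /\
  exists g : gpoint j Y -> gpoint j X, [/\ regular g, cancel f g & cancel g f].

Definition isomorphic (k L : fieldType) (j : {rmorphism k -> L})
    (X Y : projvar k) : Prop :=
  exists f : gpoint j X -> gpoint j Y, isomorphism f.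

Definition automorphism (k L : fieldType) (j : {rmorphism k -> L})
    (X : projvar k) (f : gpoint j X -> gpoint j X) : Prop :=
  isomorphism f.

Definition algebraic_closure (k : fieldType) (L : closedFieldType)
    (j : {rmorphism k -> L}) : Prop :=
  forall z : L, algebraicOver j z.

Definition severi_brauer_surface (k : fieldType) (L : closedFieldType)
    (j : {rmorphism k -> L}) (S : projvar k) : Prop :=
  isomorphic (idfun : {rmorphism L -> L}) (base_change j S) (pn L 2).

Definition nontrivial_severi_brauer_surface (k : fieldType)
    (L : closedFieldType) (j : {rmorphism k -> L}) (S : projvar k) : Prop :=
  severi_brauer_surface j S /\ ~ isomorphic j S (pn k 2).

Definition contains_all_roots_of_unity (k : fieldType) (L : closedFieldType)
    (j : {rmorphism k -> L}) : Prop :=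
  forall (n : nat) (z : L), (0 < n)%N -> z ^+ n = 1 -> exists a : k, j a = z.

(* A finite subgroup of Aut(X), presented as a finite group gT with an
   injective homomorphism rho to Aut(X). *)
Definition finite_aut_group (k L : fieldType) (j : {rmorphism k -> L})
    (X : projvar k) (gT : finGroupType)
    (rho : gT -> gpoint j X -> gpoint j X) : Prop :=
  [/\ forall g, automorphism (rho g),
      forall g h, rho (g * h)%g =1 rho g \o rho h
    & forall g h, rho g =1 rho h -> g = h].

(* Main.v *)
Require Import Defs.
From HB Require Import structures.
From mathcomp Require Import all_boot all_order all_algebra all_fingroup.
From mathcomp Require Import all_solvable ring zify.
From mathcomp Require boolp classical_sets.
Set Implicit Arguments.
Unset Strict Implicit.
Unset Printing Implicit Defensive.
Import GRing.Theory.
Local Open Scope ring_scope.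

(** Write L for the algebraic closure, and fix an isomorphism of S with the
    plane over L.  An automorphism of the plane is linear
    ([automorphism_pn_linear]), so g in G becomes a 3 x 3 matrix M_g over L,
    normalized by det M_g = 1.  For the same reason an automorphism s of L over
    K, acting on the L-points of S, becomes a semilinear map v |-> v^s C_s.
    Since g is defined over K the two commute up to a scalar:
    C_s M_g = k M_g^s C_s, and taking determinants gives k^3 = 1.

    S has no point fixed by all s, for otherwise it would be the plane over K
    ([rational_point_split]); so no line of L^3 is invariant under all the
    v |-> v^s C_s.  Now M_g has finite order modulo scalars and determinant 1,
    so its eigenvalues are roots of unity; they lie in K and are fixed by s, and
    the semilinear map of s sends the eigenspace of x to that of kx.  If g <> 1
    and k were 1 for every s, then, x being an eigenvalue, kernel and image of
    M_g - x would be invariant, and one of them is a line.  So k <> 1 for some s;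
    the eigenvalues of M_g are x, kx and k^2 x, its characteristic polynomial is
    X^3 - x^3, and therefore M_g^3 is scalar and M_g has trace 0
    ([char_poly_nontrivial]).  Hence G has exponent 3, and
    tr (M_g M_h^-1) = 0 for g <> h, which makes the matrices M_g linearly
    independent in a space of dimension 9: |G| <= 9.  A group of exponent 3 and
    order at most 9 is elementary abelian of rank at most 2
    ([small_exponent3_isog]).

    The argument rests on three ingredients.  Linearity of automorphisms needs a
    regular map between projective spaces to be given globally by forms, which
    is unique factorization of polynomials in several variables ([mpoly_ufd],
    [global_forms]); a degree count does the rest.  Automorphisms of L over K
    come from Zorn's lemma ([gal_moves]); only finitely many of their values
    matter at a time, and Dedekind independence ([independence]) holds at such a
    finite level.  Independence gives descent of Galois equivariant regular maps
    ([regular_descent]) and Hilbert 90 ([ex_invariant_basis]); with these, a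
    rational point v turns C_s, rescaled so that v^s C_s = v, into a genuine
    cocycle of invertible matrices, which is trivial. *)

(** * Unique factorization *)

Section Divisibility.
Variable R : idomainType.
Implicit Types a b c p u : R.

Definition divides a b := exists c, b = c * a.

Definition prime_elt p :=
  [/\ p != 0, ~ divides p 1 &
      forall a b, divides p (a * b) -> divides p a \/ divides p b].

Definition factorization u (s : seq R) :=
  divides u 1 /\ forall p, p \in s -> prime_elt p.

(** Existence suffices: primes being defined by their divisibility property, the
    factorization is then unique up to units. *)
Definition is_ufd := forall a, a != 0 ->
  exists u s, factorization u s /\ a = u * \prod_(p <- s) p.

Lemma divides_mull a b c : divides a b -> divides a (c * b).
Proof. by case=> k ->; exists (c * k); rewrite mulrA. Qed.

Lemma divides_mulr a b c : divides a b -> divides a (b * c).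
Proof. by rewrite mulrC; apply: divides_mull. Qed.

Lemma divides_trans b a c : divides a b -> divides b c -> divides a c.
Proof. by move=> ab [k ->]; apply: divides_mull. Qed.

Lemma factorization_cons u p s :
  factorization u (p :: s) -> prime_elt p /\ factorization u s.
Proof.
move=> [hu hs]; split; first by apply: hs; rewrite mem_head.
by split=> // q qs; apply: hs; rewrite inE qs orbT.
Qed.

(** Dividing by a prime removes it from the list, so the length of the list is a
    measure for induction on factorizations. *)
Lemma factorization_divp p a u s :
  prime_elt p -> factorization u s -> p * a = u * \prod_(q <- s) q ->
  exists u' s', [/\ factorization u' s', (size s' < size s)%N &
    a = u' * \prod_(q <- s') q].
Proof.
move=> [p0 pU pP]; elim: s a => [|q s IHs] a.
  case=> -[v uv _]; rewrite big_nil mulr1 => pau; case: pU.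
  by exists (v * a); rewrite -mulrA [a * p]mulrC pau.
move=> hs; have [[q0 qU qP] hs'] := factorization_cons hs.
rewrite big_cons => e.
have: divides p (q * (u * \prod_(q0 <- s) q0)).
  by exists a; rewrite [a * p]mulrC e mulrCA.
case/pP => [|] [k ek].
- have [h|[l el]] : divides q k \/ divides q p by apply: qP; exists 1; rewrite mul1r.
    case: h => l el; case: pU; exists l.
    by apply: (mulfI q0); rewrite mulr1 {1}ek el mulrAC mulrC.
  have lk1 : l * k = 1.
    by apply: (mulIf q0); rewrite mul1r {2}ek el mulrA [l * k]mulrC.
  exists (k * u), s; split=> //; last first.
    by apply: (mulfI p0); rewrite e {1}ek; ring.
  case: hs' => -[v uv] hs'; split=> //; exists (v * l).
  by rewrite -mulrA (mulrA l) lk1 mul1r.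
have [u' [s' [h1 h2 h3]]] := IHs k hs' (esym (etrans ek (mulrC k p))).
exists u', (q :: s'); split=> //.
  case: h1 => ? h1; split=> // r; rewrite inE => /predU1P[->|/h1] //.
apply: (mulfI p0); rewrite e big_cons mulrCA ek h3; ring.
Qed.

(** A vector F whose entries have no common prime factor generates all the vectors
    proportional to it: an entry F j divides F' j * F i for every i, and each prime
    of F j fails to divide some F i, so it can be cancelled and F j divides F' j. *)
Lemma divides_proportional (I : finType) (F F' : I -> R) :
  is_ufd -> (exists i, F i != 0) ->
  (forall p, prime_elt p -> exists i, ~ divides p (F i)) ->
  (forall i j, F i * F' j = F j * F' i) ->
  exists u, forall i, F' i = u * F i.
Proof.
move=> ufdR [j Fj0] primF FF'.
have [u [s [us eFj]]] := ufdR _ Fj0.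
have [w ew] : divides (F j) (F' j).
  have {}FF' i : divides (F j) (F' j * F i) by exists (F' i); rewrite mulrC FF' mulrC.
  rewrite eFj in FF' *.
  elim: s (F' j) us FF' {eFj} => [|p s IHs] b us FF'.
    rewrite big_nil mulr1; case: us => -[v ev] _.
    by exists (b * v); rewrite -mulrA -ev mulr1.
  have [pP us'] := factorization_cons us; have [p0 pU pp] := pP.
  have [i pFi] := primF p pP; rewrite big_cons.
  have: divides p (b * F i).
    apply: divides_trans (FF' i); rewrite big_cons mulrCA.
    by apply/divides_mulr; exists 1; rewrite mul1r.
  case/pp => // -[b' eb]; have [|c ec] := IHs b' us'.
    move=> k; have [c] := FF' k; rewrite big_cons eb => e.
    by exists c; apply: (mulIf p0); rewrite mulrAC e [p * _]mulrC !mulrA.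
  by exists c; rewrite eb ec [p * _]mulrC !mulrA.
by exists w => i; apply: (mulfI Fj0); rewrite -FF' ew; ring.
Qed.

End Divisibility.

Lemma ufd_iso (A B : idomainType) (f : {rmorphism A -> B}) (g : B -> A) :
  cancel f g -> cancel g f -> is_ufd B -> is_ufd A.
Proof.
move=> fK gK ufdB a a0.
have fdiv x y : divides x y <-> divides (f x) (f y).
  split=> -[c]; first by move=> ->; exists (f c); rewrite rmorphM.
  move=> e; exists (g c); apply: (can_inj fK).
  by rewrite rmorphM gK.
have fa0 : f a != 0 by rewrite -(rmorph0 f) (inj_eq (can_inj fK)).
have [u [s [[hu hs] e]]] := ufdB _ fa0.
exists (g u), (map g s); split; last first.
  apply: (can_inj fK); rewrite e rmorphM gK rmorph_prod big_map.
  by congr (_ * _); apply: eq_bigr => i _; rewrite /= gK.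
split=> [|_ /mapP[p /hs [p0 pU pP] ->]].
  by apply/fdiv; rewrite gK rmorph1.
split=> [||x y].
- by apply: contraNneq p0 => h; rewrite -(gK p) h rmorph0.
- by move/fdiv; rewrite gK rmorph1.
by move/fdiv; rewrite gK rmorphM => /pP[h|h]; [left|right]; apply/fdiv; rewrite gK.
Qed.

Section PolyUfd.
Variable R : idomainType.
Hypothesis ufdR : is_ufd R.
Implicit Types (p q a b d : {poly R}) (c x : R).

Definition primitive p := forall x, prime_elt x -> ~ divides x%:P p.

Lemma divides_polyC1 c : divides c%:P 1 -> divides c 1.
Proof.
case=> q e; exists q`_0; move/(congr1 (fun r : {poly R} => r`_0)): e.
by rewrite coefMC coefC.
Qed.

(** A prime of R dividing a * b divides the product of the leading coefficients,
    hence one of them; the corresponding leading term can then be removed. *)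
Lemma prime_polyC x : prime_elt x -> prime_elt x%:P.
Proof.
case=> x0 xU xP; split; first by rewrite polyC_eq0.
  by move/divides_polyC1.
move=> a b; have [n] := ubnP (size a + size b).
elim: n a b => // n IHn a b; rewrite ltnS => le_n.
have [-> _|a0] := eqVneq a 0; first by left; exists 0; rewrite mul0r.
have [-> _|b0] := eqVneq b 0; first by right; exists 0; rewrite mul0r.
have lead_drop q : q != 0 -> (size (q - lead_coef q *: 'X^((size q).-1))%R < size q)%N.
  move=> q0; have sq : (0 < size q)%N by rewrite size_poly_gt0.
  rewrite -{2}(prednK sq) ltnS; apply/leq_sizeP => i le_i.
  rewrite coefB coefZ coefXn; case: ltngtP le_i => // [lt_i _|<- _].
    by rewrite mulr0 subr0 nth_default // -(prednK sq).
  by rewrite mulr1 subrr.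
have drop_div y q : divides x y -> divides x%:P (y *: q).
  by case=> k ->; exists (k *: q); rewrite -scalerAl [q * _]mulrC mul_polyC scalerA.
have sub_div q r : divides x%:P q -> divides x%:P (q - r) -> divides x%:P r.
  by case=> k1 e1 [k2 e2]; exists (k1 - k2); rewrite mulrBl -e1 -e2 opprB addrC subrK.
have add_div q r : divides x%:P r -> divides x%:P (q - r) -> divides x%:P q.
  by case=> k1 e1 [k2 e2]; exists (k2 + k1); rewrite mulrDl -e1 -e2 subrK.
move=> [k e].
have: divides x (lead_coef a * lead_coef b).
  by exists (lead_coef k); rewrite -lead_coefM e lead_coefM lead_coefC.
case/xP => /drop_div hd.
- have [||h|] := IHn (a - lead_coef a *: 'X^((size a).-1)) b; last by right.
  + by apply: leq_trans le_n; rewrite ltn_add2r lead_drop.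
  + apply: (sub_div (a * b)); first by exists k.
    by rewrite mulrBl subKr; apply: divides_mulr.
  by left; apply: add_div h.
- have [||h|h] := IHn a (b - lead_coef b *: 'X^((size b).-1)).
  + by apply: leq_trans le_n; rewrite ltn_add2l lead_drop.
  + apply: (sub_div (a * b)); first by exists k.
    by rewrite mulrBr subKr; apply: divides_mull.
  + by left.
  by right; apply: add_div h.
Qed.

(** Gauss's lemma, in the form that turns divisibility over the fraction field,
    up to a constant c, into divisibility over R. *)
Lemma primitive_cancel p b c : primitive p -> c != 0 ->
  divides p (c%:P * b) -> divides p b.
Proof.
move=> pp /ufdR[u [s [us ->]]]; elim: s b us => [|x s IHs] b us.
  rewrite big_nil mulr1; case: us => -[v ev] _ [k ek].
  by exists (v%:P * k); rewrite -mulrA -ek mulrA -polyCM -ev mul1r.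
have [xP us'] := factorization_cons us.
rewrite big_cons mulrCA polyCM -mulrA => -[k ek].
have xPC := prime_polyC xP; have [x0 xU xp] := xPC.
have [[l el]|] : divides x%:P k \/ divides x%:P p; last by move/pp.
  by apply: xp; exists ((u * \prod_(j <- s) j)%:P * b); rewrite -ek mulrC.
apply: IHs us' _; exists l; apply: (mulfI x0).
by rewrite ek el mulrAC mulrC.
Qed.

(** The other form of Gauss's lemma: a factorization over the fraction field
    comes from one over R, with factors changed by constants only. *)
Lemma factor_cancel p d q c : c != 0 -> p != 0 -> c%:P * p = d * q ->
  exists d' q' x, [/\ p = d' * q', x != 0 & d = x%:P * d'].
Proof.
move=> /ufdR[u [s [us ->]]] p0; elim: s d q us => [|x s IHs] d q us.
  rewrite big_nil mulr1; case: us => -[v ev] _ e.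
  exists d, (v%:P * q), 1; split; rewrite ?mul1r ?oner_eq0 //.
  by rewrite mulrCA -e mulrA -polyCM -ev mul1r.
have [xP us'] := factorization_cons us.
rewrite big_cons mulrCA polyCM -mulrA => e.
have [x0 xU xp] := prime_polyC xP.
have : divides x%:P (d * q) by rewrite -e; apply: divides_mulr; exists 1; rewrite mul1r.
case/xp => -[l el].
- have [|d' [q' [y [e1 e2 e3]]]] := IHs l q us'.
    by apply: (mulfI x0); rewrite e el mulrAC mulrC.
  exists d', q', (x * y); split=> //; first by rewrite mulf_neq0 // -polyC_eq0.
  by rewrite el e3 polyCM mulrAC [y%:P * _]mulrC.
by apply: IHs us' _; apply: (mulfI x0); rewrite e el mulrA mulrC.
Qed.

Lemma poly_unit_size p : divides p 1 -> size p = 1%N.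
Proof.
move=> h; apply/eqP; have: p %| 1 by case: h => c ->; apply: dvdp_mull.
by rewrite dvdp1.
Qed.

(** Pseudo-division gives gcds up to constants.  If p is coprime to a in that
    sense, it divides b up to a constant; otherwise the gcd is a factor of p of
    positive degree, so it is associate to p and p divides a up to a constant.  The
    two forms of Gauss's lemma remove the constants. *)
Lemma irreducible_prime p : (1 < size p)%N ->
  (forall a b, p = a * b -> divides a 1 \/ divides b 1) -> prime_elt p.
Proof.
move=> sp irr; have p0 : p != 0 by rewrite -size_poly_gt0 ltnW.
have pp : primitive p.
  move=> x [x0 xU _] [k ek]; case: (irr _ _ ek).
    move/poly_unit_size/eqP/size_poly1P => [c c0 e]; move: sp.
    by rewrite ek e -polyCM size_polyC mulf_neq0.
  by move/divides_polyC1.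
split=> [//||a b [k ek]]; first by move/poly_unit_size=> h; rewrite h in sp.
have [cop|ncop] := boolP (coprimep p a).
  right; have : p %| b by rewrite -(Gauss_dvdpr _ cop) ek dvdp_mull.
  case/Pdiv.Idomain.dvdpP => -[c q] /= c0 e; apply: (primitive_cancel pp c0).
  by exists q; rewrite mul_polyC.
left; have sd : size (gcdp p a) != 1%N by [].
have [[c q] /= c0 e] := Pdiv.Idomain.dvdpP _ _ (dvdp_gcdl p a).
rewrite -mul_polyC [q * _]mulrC in e.
have [d' [q' [x [e1 x0 e2]]]] := factor_cancel c0 p0 e.
have [|[v ev]] := irr _ _ e1.
  move/poly_unit_size => h; move: sd; rewrite e2 mul_polyC size_scale // h //.
have [[c2 q2] /= c20 ea] := Pdiv.Idomain.dvdpP _ _ (dvdp_gcdr p a).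
apply: (primitive_cancel pp c20); rewrite mul_polyC ea.
apply: divides_mull; rewrite e2; apply: divides_mull.
by exists v; rewrite e1 mulrCA -ev mulr1.
Qed.

Lemma factorization_mul (S : idomainType) (a b : S) :
  (exists u s, factorization u s /\ a = u * \prod_(p <- s) p) ->
  (exists u s, factorization u s /\ b = u * \prod_(p <- s) p) ->
  (exists u s, factorization u s /\ a * b = u * \prod_(p <- s) p).
Proof.
case=> [u [s [[[u' hu] hs] ->]]] [v [t [[[v' hv] ht] ->]]].
exists (u * v), (s ++ t); split; last by rewrite big_cat mulrACA.
split; first by exists (u' * v'); rewrite mulrACA -hu -hv mulr1.
by move=> p; rewrite mem_cat => /orP[/hs|/ht].
Qed.

Lemma factorization_polyC c : c != 0 ->
  exists u s, factorization u s /\ c%:P = u * \prod_(p <- s) p.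
Proof.
move=> /ufdR[u [s [[[v ev] hs] ->]]].
exists u%:P, (map polyC s); split; last first.
  by rewrite polyCM rmorph_prod big_map.
split; first by exists v%:P; rewrite -polyCM -ev.
by move=> _ /mapP[x /hs xP ->]; apply: prime_polyC.
Qed.

(** A nonconstant primitive polynomial has no constant factors but units, so its
    proper factors have smaller degree. *)
Lemma primitive_factorization p : p != 0 -> primitive p ->
  exists u s, factorization u s /\ p = u * \prod_(p <- s) p.
Proof.
have [n] := ubnP (size p); elim: n p => // n IHn p; rewrite ltnS => le_n p0 pp.
have [sp|sp] := leqP (size p) 1.
  have -> : p = (p`_0)%:P by apply: size1_polyC.
  by apply: factorization_polyC; move: p0; rewrite {1}(size1_polyC sp) polyC_eq0.
case: (boolp.EM (exists a b, [/\ p = a * b, ~ divides a 1 & ~ divides b 1])); last first.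
  move=> irr; exists 1, [:: p]; split; last by rewrite big_seq1 mul1r.
  split; first by exists 1; rewrite mulr1.
  move=> q; rewrite inE => /eqP ->; apply: irreducible_prime sp _ => a b e.
  case: (boolp.EM (divides a 1)); first by left.
  case: (boolp.EM (divides b 1)); first by right.
  by move=> hb ha; case: irr; exists a, b.
case=> a [b [e aU bU]].
have primM (x y : {poly R}) : p = x * y -> ~ divides x 1 -> primitive x /\ (1 < size x)%N.
  move=> exy xU; have px : primitive x.
    by move=> c cP h; apply: (pp c) => //; rewrite exy; apply: divides_mulr.
  split=> //; rewrite ltnNge; apply/negP => sx.
  have x0 : x != 0 by apply: contraNneq p0 => h; rewrite exy h mul0r.
  move: x0 px xU; rewrite (size1_polyC sx) polyC_eq0 => /ufdR.
  case=> u [[|c s] [[[v ev] hs] ->]] px xU.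
    by rewrite big_nil mulr1 in xU; apply: xU; exists v%:P; rewrite -polyCM -ev.
  apply: (px c); first by apply: hs; rewrite mem_head.
  rewrite big_cons mulrCA polyCM; apply: divides_mulr.
  by exists 1; rewrite mul1r.
have [pa sa] := primM _ _ e aU; have [pb sb] := primM _ _ (etrans e (mulrC _ _)) bU.
have [a0 b0] : a != 0 /\ b != 0 by apply/andP; rewrite -negb_or -mulf_eq0 -e.
have sab : size p = (size a + size b).-1 by rewrite e size_mul.
rewrite e; apply: factorization_mul; apply: IHn => //; apply: leq_trans le_n.
  by rewrite sab; lia.
by rewrite sab; lia.
Qed.

(** Extracting a common prime factor of the coefficients shortens a factorization
    of the leading coefficient, so the extraction stops. *)
Lemma content_primitive p : p != 0 ->
  exists c q, [/\ c != 0, primitive q & p = c%:P * q].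
Proof.
move=> p0; have lp0 : lead_coef p != 0 by rewrite lead_coef_eq0.
have [u [s [us e]]] := ufdR lp0.
have [n] := ubnP (size s); elim: n p u s p0 us e {lp0} => // n IHn p u s p0 us e.
rewrite ltnS => le_n.
case: (boolp.EM (primitive p)) => [pp|npp].
  by exists 1, p; rewrite oner_eq0 mul1r.
have [x [xP [q eq]]] : exists x, prime_elt x /\ divides x%:P p.
  apply: boolp.contrapT => h; apply: npp => x xP xp; apply: h.
  by exists x.
have q0 : q != 0 by apply: contraNneq p0 => h; rewrite eq h mul0r.
have [|u' [s' [h1 h2 h3]]] := factorization_divp (a := lead_coef q) xP us.
  by rewrite -e eq lead_coefM lead_coefC mulrC.
have [c [r [c0 pr er]]] := IHn q u' s' q0 h1 h3 (leq_trans h2 le_n).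
exists (x * c), r; split=> //; first by case: xP => ? _ _; rewrite mulf_neq0.
by rewrite eq er polyCM mulrC mulrA.
Qed.

Lemma poly_ufd : is_ufd {poly R}.
Proof.
move=> p p0; have [c [q [c0 pq e]]] := content_primitive p0.
rewrite e; apply: factorization_mul; first exact: factorization_polyC.
by apply: primitive_factorization pq; apply: contraNneq p0 => h; rewrite e h mulr0.
Qed.

End PolyUfd.

Lemma mpoly_rmorph_ext (R : comNzRingType) (n : nat) (S : nzRingType)
    (f g : {rmorphism {mpoly R[n]} -> S}) :
  (forall c, f c%:MP = g c%:MP) -> (forall i, f 'X_i = g 'X_i) -> f =1 g.
Proof.
move=> hC hX p; rewrite [p]mpolyE !rmorph_sum; apply: eq_bigr => m _.
rewrite -mul_mpolyC !rmorphM hC mpolyXE_id !rmorph_prod /=; congr (_ * _).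
by apply: eq_bigr => i _; rewrite !rmorphXn hX.
Qed.

Section Muni.
Variables (L : fieldType) (n : nat).

Definition muni_inv : {rmorphism {poly {mpoly L[n]}} -> {mpoly L[n.+1]}} :=
  horner_eval 'X_ord_max \o map_poly (@mwiden n L).

Lemma muni_widen i : muni ('X_(widen_ord (leqnSn n) i) : {mpoly L[n.+1]}) = ('X_i)%:P.
Proof.
rewrite muniE msuppX big_seq1 mcoeffX eqxx scale1r mnmE.
rewrite -val_eqE /= (ltn_eqF (ltn_ord i)) expr0 alg_polyC; congr (_%:P).
by congr ('X_[_]); apply/mnmP => k; rewrite !mnmE -(inj_eq val_inj).
Qed.

Lemma muni_max : muni ('X_ord_max : {mpoly L[n.+1]}) = 'X.
Proof.
rewrite muniE msuppX big_seq1 mcoeffX eqxx scale1r mnmE eqxx expr1.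
have -> : [multinom U_(@ord_max n)%MM (widen_ord (leqnSn n) i) | i < n] = 0%MM.
  by apply/mnmP => k; rewrite !mnmE -(inj_eq val_inj) /= gtn_eqF.
by rewrite mpolyX0 scale1r.
Qed.

Lemma muniK : cancel (@muni n L) muni_inv.
Proof.
move=> p; apply: (mpoly_rmorph_ext (f := muni_inv \o @muni n L) (g := idfun)) => [c|i] /=.
  by rewrite muniC /horner_eval map_polyC hornerC /= mwidenC.
have [k ->|->] := unliftP ord_max i.
  have -> : lift ord_max k = widen_ord (leqnSn n) k.
    by apply: val_inj; rewrite /= /bump leqNgt ltn_ord.
  rewrite muni_widen /horner_eval map_polyC hornerC /= mwidenX.
  by congr ('X_[_]); rewrite mnmwiden1.
by rewrite muni_max /horner_eval map_polyX hornerX.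
Qed.

Lemma muni_invK : cancel muni_inv (@muni n L).
Proof.
move=> p; pose f : {rmorphism {poly {mpoly L[n]}} -> _} := @muni n L \o muni_inv.
have hC q : f q%:P = q%:P.
  apply: (mpoly_rmorph_ext (f := @muni n L \o muni_inv \o polyC) (g := polyC)) => [c|i] /=.
    by rewrite /horner_eval map_polyC hornerC /= mwidenC muniC.
  rewrite /horner_eval map_polyC hornerC /= mwidenX -muni_widen.
  by congr (muni 'X_[_]); rewrite mnmwiden1.
have hX : f 'X = 'X.
  by rewrite /= /horner_eval map_polyX hornerX muni_max.
change (f p = p); elim/poly_ind: p => [|p c IHp]; first exact: rmorph0.
by rewrite rmorphD rmorphM IHp hC hX.
Qed.

End Muni.

(** Gauss's theorem, one variable at a time through the isomorphism of
    {mpoly L[n.+1]} with polynomials over {mpoly L[n]}. *)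
Lemma mpoly_ufd (L : fieldType) (n : nat) : is_ufd {mpoly L[n]}.
Proof.
elim: n => [|n IHn]; last first.
  exact: (ufd_iso (@muniK L n) (@muni_invK L n) (poly_ufd IHn)).
move=> a a0; exists a, [::]; rewrite big_nil mulr1; split=> //; split=> //.
have e := nvar0_mpolyC a; rewrite e in a0 *; rewrite mpolyC_eq0 in a0.
by exists (a@_0)^-1%:MP; rewrite -mpolyCM mulVf.
Qed.

Lemma monomial_factor (R : idomainType) (a b : {poly R}) c n : c != 0 ->
  a * b = c *: 'X^n -> exists x e, a = x *: 'X^e.
Proof.
move=> c0; elim: n a b => [|n IHn] a b e.
  have : size (a * b) = 1%N by rewrite e expr0 size_scale ?size_poly1.
  move=> /eqP; rewrite size_mul_eq1 => /andP[].
  move=> /size_poly1P[x x0 ->] _; exists x, 0%N.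
  by rewrite expr0 alg_polyC.
have /eqP : (a * b).[0] = 0 by rewrite e hornerZ hornerXn expr0n mulr0.
rewrite hornerM mulf_eq0 => /orP[] /factor_theorem[q]; rewrite subr0 => eq.
- have [|x [k ek]] := IHn q b.
    by apply: (mulIf (negbT (polyX_eq0 R))); rewrite mulrAC -eq e exprSr scalerAl.
  by exists x, k.+1; rewrite eq ek exprSr scalerAl.
apply: (IHn a q); apply: (mulIf (negbT (polyX_eq0 R))).
by rewrite -mulrA -eq e exprSr scalerAl.
Qed.

Section Homogenization.
Variables (L : fieldType) (n : nat).

(** Substituting X_i * T for X_i: the coefficient of T^k is the homogeneous
    component of degree k, so forms become monomials in T. *)
Definition grade : {rmorphism {mpoly L[n]} -> {poly {mpoly L[n]}}} :=
  mmap (polyC \o @mpolyC n L) (fun i => ('X_i)%:P * 'X).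

Lemma coef_grade p k : (grade p)`_k = pihomog mdeg k p.
Proof.
rewrite /= pihomogE [RHS]big_mkcond coef_sum; apply: eq_bigr => m _ /=.
have -> : mmap1 (fun i => ('X_i : {mpoly L[n]})%:P * 'X) m = ('X_[m])%:P * 'X^(mdeg m).
  rewrite /mmap1 mdegE -prodrXr mpolyXE_id rmorph_prod -big_split /=.
  by apply: eq_bigr => i _; rewrite exprMn rmorphXn.
rewrite mulrA -polyCM coefCM coefXn mul_mpolyC eq_sym.
by case: eqP => _; rewrite ?mulr1 ?mulr0.
Qed.

Lemma grade_horner1 p : (grade p).[1] = p.
Proof.
apply: (mpoly_rmorph_ext (f := horner_eval 1 \o grade) (g := idfun)) => [c|i] /=.
  by rewrite mmapC /= /horner_eval hornerC.
by rewrite mmapX mmap1U /horner_eval hornerM hornerC hornerX mulr1.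
Qed.

(** In one variable T over a domain a factor of a monomial is a monomial. *)
Lemma homog_factor (p q : {mpoly L[n]}) d :
  p * q != 0 -> p * q \is d.-homog -> exists e, p \is e.-homog.
Proof.
move=> pq0 hpq; have epq : grade p * grade q = (p * q) *: 'X^d.
  rewrite -rmorphM; apply/polyP => k; rewrite coef_grade coefZ coefXn.
  have [->|kd] := eqVneq k d; first by rewrite pihomog_dE // mulr1.
  by rewrite mulr0 (pihomog_ne0 _ hpq) // eq_sym.
have [x [e ep]] := monomial_factor pq0 epq; exists e.
rewrite homog_piE -coef_grade -{2}(grade_horner1 p) ep.
by rewrite coefZ coefXn eqxx hornerZ hornerXn expr1n.
Qed.

End Homogenization.

(** * Forms and their values *)

Section Forms.
Variable L : fieldType.

Definition ev n (p : {mpoly L[n]}) (v : 'rV[L]_n) : L := p.@[fun i => v 0 i].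

Definition evs n m (F : 'I_m -> {mpoly L[n]}) (v : 'rV[L]_n) : 'rV[L]_m :=
  \row_i ev (F i) v.

Lemma evM n (p q : {mpoly L[n]}) v : ev (p * q) v = ev p v * ev q v.
Proof. exact: mevalM. Qed.

Lemma evB n (p q : {mpoly L[n]}) v : ev (p - q) v = ev p v - ev q v.
Proof. exact: mevalB. Qed.

Lemma evsM n m p (F : 'I_m -> {mpoly L[n]}) v :
  evs (fun i => p * F i) v = ev p v *: evs F v.
Proof. by apply/rowP => i; rewrite !mxE evM. Qed.

Lemma evX n i (v : 'rV[L]_n) : ev 'X_i v = v 0 i.
Proof. exact: mevalXU. Qed.

Lemma ev_scale n (p : {mpoly L[n]}) d c v :
  p \is d.-homog -> ev p (c *: v) = c ^+ d * ev p v.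
Proof.
move=> /dhomogP hp; rewrite /ev !mevalE mulr_sumr big_seq [RHS]big_seq.
apply: eq_bigr => m mp; rewrite mulrCA; congr (_ * _).
rewrite -(hp m mp) /= mdegE -prodrXr -big_split /=.
by apply: eq_bigr => i _; rewrite mxE exprMn.
Qed.

Lemma evs_scale n m (F : 'I_m -> {mpoly L[n]}) d c v :
  (forall i, F i \is d.-homog) -> evs F (c *: v) = c ^+ d *: evs F v.
Proof. by move=> hF; apply/rowP => i; rewrite !mxE (ev_scale _ _ (hF i)). Qed.

Definition mcomp n m (G : {mpoly L[m]}) (F : 'I_m -> {mpoly L[n]}) :=
  G \mPo [tuple F i | i < m].

Lemma ev_mcomp n m (G : {mpoly L[m]}) (F : 'I_m -> {mpoly L[n]}) v :
  ev (mcomp G F) v = ev G (evs F v).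
Proof.
rewrite /ev comp_mpoly_meval; apply: meval_eq => i.
by rewrite mxE tnth_mktuple.
Qed.

Lemma homog_bigprod n I (r : seq I) (f : I -> {mpoly L[n]}) (deg : I -> nat) :
  (forall i, f i \is (deg i).-homog) ->
  \prod_(i <- r) f i \is (\sum_(i <- r) deg i).-homog.
Proof.
move=> hf; elim: r => [|i r IHr]; first by rewrite !big_nil dhomog1.
by rewrite !big_cons; apply: dhomogM.
Qed.

Lemma mcomp_homog n m (G : {mpoly L[m]}) (F : 'I_m -> {mpoly L[n]}) e d :
  G \is e.-homog -> (forall i, F i \is d.-homog) -> mcomp G F \is (d * e).-homog.
Proof.
move=> /dhomogP hG hF; rewrite /mcomp comp_mpolyEX big_seq; apply: rpred_sum => m0 /hG <-.
apply: rpredZ; rewrite comp_mpolyX /= mdegE big_distrr; apply: homog_bigprod => i.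
by rewrite tnth_mktuple; apply: dhomogMn.
Qed.

End Forms.

Lemma mmap_horner (L : fieldType) n (a : 'I_n -> {poly L}) (p : {mpoly L[n]}) t :
  (mmap polyC a p).[t] = ev p (\row_i (a i).[t]).
Proof.
pose f : {rmorphism {mpoly L[n]} -> {poly L}} := mmap polyC a.
apply: (mpoly_rmorph_ext (f := horner_eval t \o f)
  (g := meval (fun i => (\row_i (a i).[t]) 0 i))) => [c|i] /=.
  by rewrite mmapC /horner_eval hornerC mevalC.
by rewrite mmapX mmap1U /horner_eval mevalXU mxE.
Qed.

(** By induction on n: fix the last variable after the others, at a point where the
    leading coefficient in that variable does not vanish. *)
Lemma ev_neq0 (L : closedFieldType) n (p : {mpoly L[n]}) :
  p != 0 -> exists v, ev p v != 0.
Proof.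
elim: n p => [|n IHn] p p0.
  exists 0; rewrite /ev (nvar0_mpolyC p) mevalC.
  by move: p0; rewrite {1}(nvar0_mpolyC p) mpolyC_eq0.
have : muni p != 0 by rewrite -(rmorph0 (@muni n L)) (inj_eq (can_inj (@muniK L n))).
rewrite -lead_coef_eq0 => /IHn[v hv].
have : map_poly (meval (fun i => v 0 i)) (muni p) != 0.
  by rewrite -lead_coef_eq0 lead_coef_map_eq // lead_coef_eq0; apply: contraNneq hv => ->; rewrite /ev meval0.
move=> /closed_nonrootP[t]; rewrite rootE => ht.
exists (\row_i (if unlift ord_max i is Some k then v 0 k else t)).
suff e : (map_poly (meval (fun i => v 0 i)) (muni p)).[t] =
    ev p (\row_i (if unlift ord_max i is Some k then v 0 k else t)) by rewrite -e.
pose f : {rmorphism {mpoly L[n.+1]} -> L} :=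
  horner_eval t \o map_poly (meval (fun i => v 0 i)) \o @muni n L.
apply: (mpoly_rmorph_ext (f := f)
  (g := meval (fun i => (\row_i (if unlift ord_max i is Some k then v 0 k else t)) 0 i))).
  by move=> c /=; rewrite muniC /horner_eval map_polyC hornerC /= !mevalC.
move=> i /=; rewrite mevalXU mxE; case: unliftP => [k|] ->.
  have -> : lift ord_max k = widen_ord (leqnSn n) k.
    by apply: val_inj; rewrite /= /bump leqNgt ltn_ord.
  by rewrite muni_widen /horner_eval map_polyC hornerC /= mevalXU.
by rewrite muni_max /horner_eval map_polyX hornerX.
Qed.

Lemma ev_neq0_both (L : closedFieldType) n (p q : {mpoly L[n.+1]}) :
  p != 0 -> q != 0 -> exists v, [/\ v != 0, ev p v != 0 & ev q v != 0].
Proof.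
move=> p0 q0; have X0 : 'X_ord0 != 0 :> {mpoly L[n.+1]}.
  by rewrite -msize_poly_eq0 msizeX.
have [|v] := @ev_neq0 L n.+1 ('X_ord0 * (p * q)); first by rewrite !mulf_neq0.
rewrite !evM evX !mulf_eq0 !negb_or => /and3P[v0 pv qv]; exists v; split=> //.
by apply: contraNneq v0 => ->; rewrite mxE.
Qed.

Lemma closed_const_poly (L : closedFieldType) (q : {poly L}) :
  (forall t, q.[t] != 0) -> exists2 c, c != 0 & q = c%:P.
Proof.
move=> hq; case: (boolP (size q == 1%N)) => [/size_poly1P[c c0 ->]|]; first by exists c.
by case/closed_rootP => t /rootP h; have := hq t; rewrite h eqxx.
Qed.

(** * Homogeneous coordinates and regular maps *)

Section Coordinates.
Variables (K L : fieldType) (j : {rmorphism K -> L}).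
Implicit Types X Y Z : projvar K.

(** The vector v is a system of homogeneous coordinates of x.  Working with all
    systems at once avoids the choice made by [hcoord]. *)
Definition rep X (v : 'rV[L]_(pv_dim X).+1) (x : gpoint j X) :=
  v != 0 /\ val (val x) = <[v]>%VS.

Definition onvar X (v : 'rV[L]_(pv_dim X).+1) :=
  all (fun p => peval j p v == 0) (pv_eqs X).

Lemma rep_hcoord X (x : gpoint j X) : rep (hcoord (val x)) x.
Proof.
case: x => -[U dU] hx; rewrite /rep /hcoord /=.
have U0 : vpick U != 0 by rewrite vpick0 -dimv_eq0 (eqP dU).
split=> //; apply/esym/eqP.
by rewrite eqEdim -memvE memv_pick dim_vline U0 (eqP dU).
Qed.

Lemma rep_inj X (v : 'rV[L]_(pv_dim X).+1) (x y : gpoint j X) :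
  rep v x -> rep v y -> x = y.
Proof. by move=> [_ ex] [_ ey]; do 2!apply: val_inj; rewrite ex ey. Qed.

Lemma rep_scale X c (v : 'rV[L]_(pv_dim X).+1) (x : gpoint j X) :
  c != 0 -> rep v x -> rep (c *: v) x.
Proof.
move=> c0 [v0 e]; split; first by rewrite scaler_eq0 negb_or c0.
rewrite e; apply/esym/eqP; rewrite eqEdim -memvE memvZ ?memv_line //.
by rewrite !dim_vline scaler_eq0 (negPf c0) v0.
Qed.

Lemma rep_prop X (v w : 'rV[L]_(pv_dim X).+1) (x : gpoint j X) :
  rep v x -> rep w x -> exists2 c, c != 0 & w = c *: v.
Proof.
move=> [v0 ev] [w0 ew]; have: w \in <[v]>%VS by rewrite -ev ew memv_line.
case/vlineP => c e; exists c => //.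
by apply: contraNneq w0 => c0; rewrite e c0 scale0r.
Qed.

Lemma peval_scale X p c (v : 'rV[L]_(pv_dim X).+1) :
  c != 0 -> p \in pv_eqs X -> (peval j p (c *: v) == 0) = (peval j p v == 0).
Proof.
move=> c0 pX; have := map_homog j (pv_homog X).
move=> /allP/(_ _ (map_f _ pX))/homogP[d hd].
rewrite /peval -[LHS]/(ev _ _ == 0) (ev_scale _ _ hd).
by rewrite mulf_eq0 expf_eq0 (negPf c0) andbF.
Qed.

Lemma onvar_scale X c (v : 'rV[L]_(pv_dim X).+1) :
  c != 0 -> onvar (c *: v) = onvar v.
Proof. by move=> c0; apply: eq_in_all => p pX; rewrite peval_scale. Qed.

Lemma rep_onvar X (v : 'rV[L]_(pv_dim X).+1) (x : gpoint j X) :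
  rep v x -> onvar v.
Proof.
move=> vx; have [c c0 ->] := rep_prop (rep_hcoord x) vx.
by rewrite onvar_scale //; apply: (valP x).
Qed.

Lemma rep_make X (v : 'rV[L]_(pv_dim X).+1) :
  v != 0 -> onvar v -> exists x : gpoint j X, rep v x.
Proof.
move=> v0 hv; have dv : \dim <[v]>%VS == 1%N by rewrite dim_vline v0.
pose P : pspace L (pv_dim X) := exist _ <[v]>%VS dv.
have [c c0 e] : exists2 c, c != 0 & hcoord P = c *: v.
  have : hcoord P \in <[v]>%VS by apply: memv_pick.
  case/vlineP => c e; exists c => //.
  have : hcoord P != 0 by rewrite vpick0 -dimv_eq0 (eqP dv).
  by apply: contraNneq => c0; rewrite e c0 scale0r.
have hP : onvar (hcoord P) by rewrite e onvar_scale.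
by exists (exist _ P hP).
Qed.

Lemma rep_pn n (v : 'rV[L]_n.+1) :
  v != 0 -> exists x : gpoint j (pn K n), rep (X := pn K n) v x.
Proof. by move=> v0; apply: rep_make. Qed.

(** The analogue of [regular] with coefficients in L for varieties defined over K,
    which is where maps live before they are known to descend.  The open
    neighbourhood is the set where the forms do not all vanish. *)
Definition lregular X Y (f : gpoint j X -> gpoint j Y) :=
  forall x v, rep v x -> exists d (F : 'I_(pv_dim Y).+1 -> {mpoly L[(pv_dim X).+1]}),
    [/\ forall i, F i \is d.-homog, evs F v != 0 &
        forall y w, rep w y -> evs F w != 0 -> rep (evs F w) (f y)].

Definition ext_forms m n (F : 'I_m -> {mpoly K[n]}) i : {mpoly L[n]} := map_mpoly j (F i).

Lemma ext_homog m n (F : 'I_m -> {mpoly K[n]}) d i :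
  (ext_forms F i \is d.-homog) = (F i \is d.-homog).
Proof.
by apply/dhomogP/dhomogP => h m0 hm; apply: h; rewrite ?(perm_mem (msupp_map_mpoly (F i) (fmorph_inj j))) in hm *.
Qed.

(** The neighbourhood h <> 0 of the definition is absorbed by multiplying the forms
    by h; conversely, one of the forms can serve as h. *)
Lemma regularP X Y (f : gpoint j X -> gpoint j Y) :
  regular f <->
  forall x v, rep v x -> exists d (F : 'I_(pv_dim Y).+1 -> {mpoly K[(pv_dim X).+1]}),
    [/\ forall i, F i \is d.-homog, evs (ext_forms F) v != 0 &
        forall y w, rep w y -> evs (ext_forms F) w != 0 -> rep (evs (ext_forms F) w) (f y)].
Proof.
split=> rf x; last first.
  have [d [F [hF Fx Fy]]] := rf x _ (rep_hcoord x).
  have /rV0Pn[k] := Fx; rewrite mxE => Fk; exists d, d, (F k), F; split=> // y hy.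
  have -> : \row_i peval j (F i) (hcoord (val y)) = evs (ext_forms F) (hcoord (val y)).
    by apply/rowP => i; rewrite !mxE.
  by apply: Fy (rep_hcoord y) _; apply/rV0Pn; exists k; rewrite mxE.
move=> v vx; have [e [d [h [F [hh hF hx Fy]]]]] := rf x.
have evF y : \row_i peval j (F i) (hcoord (val y)) = evs (ext_forms F) (hcoord (val y)).
  by apply/rowP => i; rewrite !mxE.
have hhF i : h * F i \is (e + d).-homog by apply: dhomogM.
have lhF i : ext_forms (fun i => h * F i) i \is (e + d).-homog by rewrite ext_homog.
have evhF w : evs (ext_forms (fun i => h * F i)) w = peval j h w *: evs (ext_forms F) w.
  by rewrite -evsM; apply/rowP => i; rewrite !mxE /ext_forms rmorphM.
exists (e + d)%N, (fun i => h * F i); split=> // [|y w wy].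
  have [w0 _] := Fy x hx; have [c c0 ->] := rep_prop (rep_hcoord x) vx.
  by rewrite (evs_scale _ _ lhF) evhF -evF !scaler_eq0 !negb_or expf_neq0 // hx.
have [c c0 ->] := rep_prop (rep_hcoord y) wy.
rewrite (evs_scale _ _ lhF) evhF !scaler_eq0 !negb_or => /and3P[cn hy Fn].
by do 2!apply: rep_scale => //; have := Fy y hy; rewrite evF => -[].
Qed.

Lemma regular_lregular X Y (f : gpoint j X -> gpoint j Y) :
  regular f -> lregular f.
Proof.
move=> /regularP rf x v /rf[d [F [hF Fv Fy]]]; exists d, (ext_forms F); split=> // i.
by rewrite ext_homog.
Qed.

(** Composing forms is not enough: if the outer forms are constant, the composite
    does not vanish where the inner forms do.  Hence the extra factor F k. *)
Lemma lregular_comp X Y Z (f : gpoint j X -> gpoint j Y) (g : gpoint j Y -> gpoint j Z) :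
  lregular f -> lregular g -> lregular (g \o f).
Proof.
move=> rf rg x v vx; have [d [F [hF Fv Fy]]] := rf x v vx.
have [e [G [hG Gv Gy]]] := rg _ _ (Fy _ _ vx Fv).
have /rV0Pn[k Fk] := Fv; rewrite mxE in Fk.
have evGF w : evs (fun i => F k * mcomp (G i) F) w = ev (F k) w *: evs G (evs F w).
  by rewrite evsM; congr (_ *: _); apply/rowP => i; rewrite !mxE ev_mcomp.
(* F k is a coordinate of F that does not vanish at v. *)
exists (d + d * e)%N, (fun i => F k * mcomp (G i) F); split=> [i||y w wy].
- by apply: dhomogM => //; apply: mcomp_homog.
- by rewrite evGF scaler_eq0 negb_or Fk.
rewrite evGF scaler_eq0 negb_or => /andP[Fkw Gw].
apply: rep_scale => //; apply: Gy Gw; apply: Fy wy _.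
by apply/rV0Pn; exists k; rewrite mxE.
Qed.

End Coordinates.

(** * Automorphisms of projective space are linear *)

Lemma homog0_const (L : fieldType) n (p : {mpoly L[n]}) :
  p \is 0.-homog -> p = (p@_0)%:MP.
Proof.
move=> /dhomogP hp; apply/mpolyP => m; rewrite mcoeffC.
case: (eqVneq 0%MM m) => [<-|m0]; first by rewrite mulr1.
rewrite mulr0; apply: memN_msupp_eq0; apply: contra m0 => /hp /eqP /=.
by rewrite mdeg_eq0 eq_sym.
Qed.

Lemma ev_linear (L : fieldType) n (p : {mpoly L[n]}) v :
  p \is 1.-homog -> ev p v = \sum_i v 0 i * ev p (delta_mx 0 i).
Proof.
move=> /dhomogP hp; have evU w : ev p w = \sum_i w 0 i * p@_U_(i).
  rewrite [in LHS](_ : p = \sum_i p@_U_(i) *: 'X_i).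
    rewrite /ev raddf_sum; apply: eq_bigr => i _ /=.
    by rewrite mevalZ mevalXU mulrC.
  apply/mpolyP => m; rewrite raddf_sum /=.
  have [/existsP[i /eqP ->]|h] := boolP [exists i, m == U_(i)%MM].
    rewrite (bigD1 i) //= mcoeffZ mcoeffX eqxx mulr1 big1 ?addr0 // => k ki.
    rewrite mcoeffZ mcoeffX; case: eqP => [/mnmP/(_ i)|]; last by rewrite mulr0.
    by rewrite !mnm1E eqxx (negPf ki).
  rewrite big1 => [|i _]; last first.
    rewrite mcoeffZ mcoeffX; case: eqP => [e|_]; last by rewrite mulr0.
    by case/existsP: h; exists i; rewrite e.
  apply: memN_msupp_eq0; apply: contra h => /hp /= /eqP.
  by rewrite mdeg_eq1.
rewrite evU; apply: eq_bigr => i _; rewrite evU (bigD1 i) //= big1 ?addr0.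
  by rewrite mxE !eqxx mul1r.
by move=> k ki; rewrite mxE (negPf ki) andbF mul0r.
Qed.

Section Linear.
Variables (K : fieldType) (L : closedFieldType) (j : {rmorphism K -> L}).

Local Notation prep n := (@rep K L j (pn K n)).

(** A common prime factor of forms is itself a form, and a nonconstant one, so
    dividing by it lowers the degree. *)
Lemma drop_common_factor n m (F : 'I_m -> {mpoly L[n]}) d p :
  (forall i, F i \is d.-homog) -> (exists i, F i != 0) ->
  prime_elt p -> (forall i, divides p (F i)) ->
  exists d' F', [/\ (d' < d)%N, forall i, F' i \is d'.-homog &
    forall i, F i = p * F' i].
Proof.
move=> hF [k Fk] [p0 pU _] pF.
have [F' eF] : exists F' : 'I_m -> {mpoly L[n]}, forall i, F i = p * F' i.
  apply: (fin_all_exists (P := fun i q => F i = p * q)) => i.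
  by case: (pF i) => q ->; exists q; rewrite mulrC.
have [b hb] : exists b, p \is b.-homog.
  by apply: (@homog_factor _ _ p (F' k) d); rewrite -eF.
have b0 : (0 < b)%N.
  case: b hb => // /homog0_const e; case: pU; rewrite e in p0 *.
  rewrite mpolyC_eq0 in p0; exists ((p@_0)^-1)%:MP.
  by rewrite -mpolyCM mulVf.
have hF' i : F' i != 0 -> exists2 e, F' i \is e.-homog & d = (b + e)%N.
  move=> F'0; have Fi0 : F i != 0 by rewrite eF mulf_neq0.
  have [e he] : exists e, F' i \is e.-homog.
    by apply: (@homog_factor _ _ (F' i) p d); rewrite mulrC -eF.
  exists e => //; apply: dhomog_uniq Fi0 (hF i) _.
  by rewrite eF; apply: dhomogM.
have [e _ ed] : exists2 e, F' k \is e.-homog & d = (b + e)%N.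
  by apply: hF'; apply: contraNneq Fk => h; rewrite eF h mulr0.
exists e, F'; split=> [|i|//]; first by rewrite ed -[X in (X < _)%N]add0n ltn_add2r.
have [->|/hF'[e' he' ed']] := eqVneq (F' i) 0; first exact: dhomog0.
by rewrite (_ : e = e') //; apply/eqP; rewrite -(eqn_add2l b) -ed ed'.
Qed.

(** As long as the forms F have a common prime factor, remove it.  Once they have
    none, the forms F' describing f near a point x are proportional to F, hence equal
    to u * F for a polynomial u; as F' does not vanish at x, neither does F, and F
    describes f at x too. *)
Lemma generic_global n m (f : gpoint j (pn K n) -> gpoint j (pn K m)) d
    (F : 'I_m.+1 -> {mpoly L[n.+1]}) (h : {mpoly L[n.+1]}) :
  lregular f -> (forall i, F i \is d.-homog) -> h != 0 ->
  (forall v y, prep n v y -> ev h v != 0 -> prep m (evs F v) (f y)) ->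
  exists e (G : 'I_m.+1 -> {mpoly L[n.+1]}),
    (forall i, G i \is e.-homog) /\
    (forall v y, prep n v y -> prep m (evs G v) (f y)).
Proof.
move=> rf; have [k] := ubnP d; elim: k d F => // k IHk d F le_d hF h0 Fh.
have Fn0 : exists i, F i != 0.
  have [v [v0 hv _]] := ev_neq0_both h0 h0.
  have [y vy] := rep_pn j v0; have [Fv _] := Fh v y vy hv.
  have /rV0Pn[i] := Fv; rewrite mxE => Fi; exists i.
  by apply: contraNneq Fi => ->; rewrite /ev meval0.
case: (boolp.EM (exists p, prime_elt p /\ forall i, divides p (F i))) => [[p [pP pF]]|coF].
  have [d' [F' [lt_d hF' eF]]] := drop_common_factor hF Fn0 pP pF.
  apply: (IHk d' F') => // [|v y vy hv]; first exact: leq_trans lt_d le_d.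
  have := Fh v y vy hv.
  have -> : evs F v = ev p v *: evs F' v by rewrite -evsM; apply/rowP => i; rewrite !mxE eF.
  move=> r; have := r.1; rewrite scaler_eq0 negb_or => /andP[pv _].
  rewrite -[evs F' v](scalerK pv).
  exact: (@rep_scale _ _ j (pn K m)) (invr_neq0 pv) r.
exists d, F; split=> // v x vx; have [e [F' [hF' Fv' Fy']]] := rf x v vx.
(* Both vectors represent the same point wherever they do not vanish, so the
   2 x 2 minors vanish on a nonempty open set. *)
have minors i l : F i * F' l = F l * F' i.
  apply/eqP; rewrite -subr_eq0; apply: boolp.contrapT => /negP/ev_neq0_both/(_ h0)[w [w0]].
  have [y wy] := rep_pn j w0; rewrite evB !evM => + hw.
  have ee (G : 'I_m.+1 -> {mpoly L[n.+1]}) t : ev (G t) w = evs G w 0 t by rewrite mxE.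
  rewrite !ee; have [->|F'w] := eqVneq (evs F' w) 0.
    by rewrite !mxE !mulr0 subrr eqxx.
  have [c c0 ->] := rep_prop (Fh w y wy hw) (Fy' y w wy F'w).
  rewrite !mxE; move: (ev _ _) (ev _ _) => s t.
  by rewrite (_ : _ - _ = 0) ?eqxx //; ring.
have [|u eu] := divides_proportional (@mpoly_ufd L n.+1) Fn0 _ minors.
  move=> p pP; apply: boolp.contrapT => hp; apply: coF; exists p; split=> // i.
  by apply: boolp.contrapT => hi; apply: hp; exists i.
have eF' : evs F' v = ev u v *: evs F v by rewrite -evsM; apply/rowP => i; rewrite !mxE eu.
have r := Fy' x v vx Fv'; rewrite eF' in r.
have := r.1; rewrite scaler_eq0 negb_or => /andP[uv _].
by rewrite -[evs F v](scalerK uv); apply: rep_scale r; rewrite invr_neq0.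
Qed.

Lemma global_forms n m (f : gpoint j (pn K n) -> gpoint j (pn K m)) :
  lregular f ->
  exists d (F : 'I_m.+1 -> {mpoly L[n.+1]}),
    (forall i, F i \is d.-homog) /\
    (forall v y, prep n v y -> prep m (evs F v) (f y)).
Proof.
move=> rf; have v0 : const_mx 1 != 0 :> 'rV[L]_n.+1.
  by apply/rV0Pn; exists 0; rewrite mxE oner_eq0.
have [x vx] := rep_pn j v0; have [d [F [hF Fv Fy]]] := rf x _ vx.
have /rV0Pn[k] := Fv; rewrite mxE => Fk.
apply: (generic_global (h := F k) rf hF) => [|v y vy Fkv].
  by apply: contraNneq Fk => ->; rewrite /ev meval0.
by apply: Fy vy _; apply/rV0Pn; exists k; rewrite mxE.
Qed.

(** On the vectors (1, 0, ..., 0, t) the first coordinate of P never vanishes, so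
    it is a constant k0; on the vectors (s, 0, ..., 0, 1) the last coordinate is
    likewise a constant k1.  For s = 1 / t the two vectors are proportional, and
    comparing the values of P gives k1 * s = k0 * s ^ D for all s <> 0. *)
Lemma identity_degree n D (P : 'I_n.+2 -> {mpoly L[n.+2]}) :
  (forall i, P i \is D.-homog) ->
  (forall v, v != 0 -> exists2 c, c != 0 & evs P v = c *: v) -> D = 1%N.
Proof.
move=> hP Pid.
pose a (k : 'I_n.+2) : {poly L} := if k == ord0 then 1 else if k == ord_max then 'X else 0.
pose b (k : 'I_n.+2) : {poly L} := if k == ord0 then 'X else if k == ord_max then 1 else 0.
pose va t := \row_k (a k).[t]; pose vb t := \row_k (b k).[t].
have va0 t : va t 0 ord0 = 1 by rewrite mxE /a eqxx hornerC.
have vam t : va t 0 ord_max = t by rewrite mxE /a -[_ == ord0]/false eqxx hornerX.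
have vbm t : vb t 0 ord_max = 1 by rewrite mxE /b -[_ == ord0]/false eqxx hornerC.
have van t : va t != 0 by apply/rV0Pn; exists ord0; rewrite va0 oner_eq0.
have vbn t : vb t != 0 by apply/rV0Pn; exists ord_max; rewrite vbm oner_eq0.
have evP i v : ev (P i) v = evs P v 0 i by rewrite mxE.
have [k0 k00 e0] : exists2 c, c != 0 & mmap polyC a (P ord0) = c%:P.
  apply: closed_const_poly => t; rewrite mmap_horner evP.
  by have [c c0 ->] := Pid _ (van t); rewrite mxE va0 mulr1.
have [k1 k10 e1] : exists2 c, c != 0 & mmap polyC b (P ord_max) = c%:P.
  apply: closed_const_poly => t; rewrite mmap_horner evP.
  by have [c c0 ->] := Pid _ (vbn t); rewrite mxE vbm mulr1.
have ab s : s != 0 -> vb s = s *: va s^-1.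
  move=> s0; apply/rowP => k; rewrite !mxE /a /b.
  case: eqP => _; first by rewrite hornerC hornerX mulr1.
  by case: eqP => _; rewrite ?hornerX ?hornerC ?mulfV ?mulr0.
have key s : s != 0 -> k1 * s = k0 * s ^+ D.
  move=> s0; have [c c0 ec] := Pid _ (van s^-1).
  have e k : evs P (va s^-1) 0 k = c * va s^-1 0 k by rewrite ec mxE.
  have := congr1 (horner^~ s) e1; rewrite /= hornerC mmap_horner -/(vb s) ab //.
  rewrite (ev_scale _ _ (hP _)) evP e vam => <-.
  have := congr1 (horner^~ s^-1) e0; rewrite /= hornerC mmap_horner -/(va _) evP e va0.
  by move=> <-; rewrite mulr1 mulrA mulfVK // mulrC.
apply/eqP; apply: contraT => D1.
have : (k1 *: 'X - k0 *: 'X^D) * 'X != 0.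
  rewrite mulf_neq0 ?polyX_eq0 //; apply/eqP => /polyP/(_ 1%N).
  rewrite coefB !coefZ coefX coefXn [_ == D]eq_sym (negPf D1) mulr0 subr0 mulr1 coef0.
  by apply/eqP.
case/closed_nonrootP => s; rewrite rootE !hornerE mulf_eq0 negb_or.
by case/andP => h s0; rewrite key // subrr eqxx in h.
Qed.

(** If f and its inverse are given by forms of degrees d and e, the composite is
    given by forms of degree d * e and is the identity, so d * e = 1. *)
Lemma automorphism_pn_linear n (f g : gpoint j (pn K n.+1) -> gpoint j (pn K n.+1)) :
  lregular f -> lregular g -> cancel f g ->
  exists2 M, M \in unitmx &
    forall v x, prep n.+1 v x -> prep n.+1 (v *m M) (f x).
Proof.
move=> /global_forms[d [F [hF Ff]]] /global_forms[e [G [hG Gg]]] fK.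
have d1 : d = 1%N.
  suff /eqP : (d * e)%N = 1%N by rewrite muln_eq1 => /andP[/eqP].
  apply: (@identity_degree n _ (fun i => mcomp (G i) F)) => [i|v v0].
    exact: mcomp_homog.
  have [x vx] := rep_pn j v0.
  have -> : evs (fun i => mcomp (G i) F) v = evs G (evs F v).
    by apply/rowP => i; rewrite !mxE ev_mcomp.
  by have := Gg _ _ (Ff _ _ vx); rewrite fK; apply: rep_prop.
rewrite {d}d1 in hF; pose M := \matrix_(i, k) ev (F k) (delta_mx 0 i).
have eM v : evs F v = v *m M.
  apply/rowP => k; rewrite !mxE (ev_linear _ (hF k)).
  by apply: eq_bigr => i _; rewrite mxE.
exists M => [|v x vx]; last by rewrite -eM; apply: Ff.
rewrite -row_free_unit; apply: inj_row_free => v vM; apply/eqP.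
apply: contraT => v0; have [x vx] := rep_pn j v0.
by have [] := Ff _ _ vx; rewrite eM vM eqxx.
Qed.

End Linear.

(** * The automorphism group of an algebraic closure *)

Section Diagonal.
Variables (K L : fieldType) (j : {rmorphism K -> L}).

Definition diag (a : K) : L * L := (j a, j a).

Fact diag_zmod_morphism : zmod_morphism diag.
Proof. by move=> a b; rewrite /diag rmorphB. Qed.

Fact diag_monoid_morphism : monoid_morphism diag.
Proof. by split=> [|a b]; rewrite /diag ?rmorph1 ?rmorphM. Qed.

HB.instance Definition _ := GRing.isZmodMorphism.Build K (L * L)%type diag
  diag_zmod_morphism.
HB.instance Definition _ := GRing.isMonoidMorphism.Build K (L * L)%type diag
  diag_monoid_morphism.

End Diagonal.

Section Extension.
Variables (K : fieldType) (L : closedFieldType) (j : {rmorphism K -> L}).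
Hypothesis algL : algebraic_closure j.

Local Notation A := (L * L)%type.
Local Notation ev1 q z := ((map_poly (fst : A -> L) q).[z]).
Local Notation ev2 q w := ((map_poly (snd : A -> L) q).[w]).
Implicit Types R : A -> Prop.

(** A partial automorphism of L over K is encoded by its graph R, a subring of
    L x L.  As L is algebraic over K, a subring of L containing K is a field, so
    the last condition makes R the graph of an isomorphism between two fields. *)
Definition partial_aut R :=
  [/\ forall a, R (diag j a), forall p q, R p -> R q -> R (p - q),
      forall p q, R p -> R q -> R (p * q) & forall y, R (0, y) -> y = 0].

Section PartialAut.
Variable R : A -> Prop.
Hypothesis autR : partial_aut R.

Let Rdiag a : R (diag j a). Proof. by case: autR => h _ _ _; apply: h. Qed.
Let RB p q : R p -> R q -> R (p - q). Proof. by case: autR => _ h _ _; apply: h. Qed.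
Let RM p q : R p -> R q -> R (p * q). Proof. by case: autR => _ _ h _; apply: h. Qed.
Let R0y y : R (0, y) -> y = 0. Proof. by case: autR => _ _ _ h; apply: h. Qed.
Let R0 : R 0. Proof. by rewrite -(rmorph0 (diag j)); apply: Rdiag. Qed.
Let R1 : R 1. Proof. by rewrite -(rmorph1 (diag j)); apply: Rdiag. Qed.
Let RD p q : R p -> R q -> R (p + q).
Proof. by move=> hp hq; rewrite -[q]opprK -[- q]add0r; apply: RB => //; apply: RB. Qed.
Let Rsum (I : Type) (r : seq I) (F : I -> A) :
  (forall i, R (F i)) -> R (\sum_(i <- r) F i).
Proof. by move=> hF; elim/big_ind: _. Qed.
Let RX p n : R p -> R (p ^+ n).
Proof. by move=> hp; elim: n => [|n IHn]; [exact: R1|]; rewrite exprS; apply: RM. Qed.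

Definition poly_in (q : {poly A}) := forall i, R q`_i.

(** If p = (a, b), then a^-1 is a polynomial s(a) over K because it is algebraic;
    the pair s(p) inverts p on the first component, hence on the second. *)
Lemma partial_aut_inv p : R p -> p != 0 -> exists2 q, R q & p * q = 1.
Proof.
case: p => a b Rab ab0; have a0 : a != 0.
  by apply: contraNneq ab0 => a0; rewrite a0 in Rab *; rewrite (R0y Rab).
have [p p0 pa] := algL a^-1; have sp : (0 < size p)%N by rewrite size_poly_gt0.
(* Solving p.[a^-1] = 0 for the leading term, multiplied by a power of a. *)
pose s : A := \sum_(i < (size p).-1)
   diag j (- (lead_coef p)^-1 * p`_i) * (a, b) ^+ ((size p).-1 - i.+1).
have Rs : R s by apply: Rsum => i; apply: RM => //; apply: RX.
have s1 : s.1 = a^-1.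
  have lp0 : j (lead_coef p) != 0 by rewrite fmorph_eq0 lead_coef_eq0.
  have {pa} : \sum_(i < (size p).-1) j p`_i * a^-1 ^+ i = - (j (lead_coef p) * a^-1 ^+ (size p).-1).
    move/rootP: pa; rewrite horner_coef size_map_poly -[in X in X = 0](prednK sp).
    rewrite big_ord_recr /= coef_map -lead_coefE /= => /eqP; rewrite addr_eq0 => /eqP <-.
    by apply: eq_bigr => i _; rewrite coef_map.
  have -> : s.1 = - (j (lead_coef p))^-1 * \sum_(i < (size p).-1) j p`_i * a ^+ ((size p).-1 - i.+1).
    rewrite [LHS](rmorph_sum (fst : {rmorphism A -> L})) mulr_sumr; apply: eq_bigr => i _.
    by rewrite rmorphM rmorphXn /= rmorphM rmorphN fmorphV mulrA.
  case: (size p).-1 => [|n].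
    by move/eqP; rewrite big_ord0 expr0 mulr1 eq_sym oppr_eq0 (negPf lp0).
  move=> e; have -> : \sum_(i < n.+1) j p`_i * a ^+ (n.+1 - i.+1) =
      a ^+ n * \sum_(i < n.+1) j p`_i * a^-1 ^+ i.
    rewrite mulr_sumr; apply: eq_bigr => i _; rewrite mulrCA; congr (_ * _).
    by rewrite subSS exprVn expfB_cond // (negPf a0) /= add0n -ltnS.
  by rewrite e exprS exprVn; field; rewrite lp0 a0 expf_neq0.
have ab1 : (a, b) * s = 1.
  apply/eqP; rewrite -subr_eq0; have Rd : R ((a, b) * s - 1) by apply: RB => //; apply: RM.
  have e1 : ((a, b) * s - 1).1 = 0 by rewrite /= s1 divff // subrr.
  rewrite [X in X == _]surjective_pairing e1 in Rd *.
  rewrite [X in R X]surjective_pairing e1 in Rd.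
  by rewrite (R0y Rd).
by exists s.
Qed.

Let poly_inB p q : poly_in p -> poly_in q -> poly_in (p - q).
Proof. by move=> hp hq i; rewrite coefB; apply: RB. Qed.
Let poly_inM p q : poly_in p -> poly_in q -> poly_in (p * q).
Proof. by move=> hp hq i; rewrite coefM; apply: Rsum => k; apply: RM. Qed.
Let poly_inZ c p : R c -> poly_in p -> poly_in (c *: p).
Proof. by move=> hc hp i; rewrite coefZ; apply: RM. Qed.
Let poly_inXn n : poly_in 'X^n.
Proof. by move=> i; rewrite coefXn; case: eqP. Qed.
Let poly_inC c : R c -> poly_in c%:P.
Proof. by move=> hc i; rewrite coefC; case: eqP. Qed.

Definition is_min_poly z (p : {poly A}) :=
  [/\ p \is monic, poly_in p, ev1 p z = 0 &
      forall q, poly_in q -> ev1 q z = 0 -> q != 0 -> (size p <= size q)%N].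

Lemma ex_min_poly z : exists p, is_min_poly z p.
Proof.
have [p0 p00 p0z] := algL z.
have : exists2 p, p \is monic & poly_in p /\ ev1 p z = 0.
  exists (map_poly (diag j) ((lead_coef p0)^-1 *: p0)).
    by rewrite map_monic monicE lead_coefZ mulVf // lead_coef_eq0.
  split=> [i|]; first by rewrite coef_map; apply: Rdiag.
  rewrite -map_poly_comp (eq_map_poly (g := j)) //.
  by rewrite map_polyZ hornerZ (rootP p0z) mulr0.
case=> p; have [n] := ubnP (size p); elim: n p => // n IHn p le_n mp [pin pz].
case: (boolp.EM (exists q, [/\ poly_in q, ev1 q z = 0, q != 0 & (size q < size p)%N])).
  case=> q [qin qz q0 lt_q].
  have lq0 : lead_coef q != 0 by rewrite lead_coef_eq0.
  have [c Rc ec] := partial_aut_inv (qin _ : R (lead_coef q)) lq0.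
  have sz : (size (c *: q) <= size q)%N by apply: size_scale_leq.
  apply: (IHn (c *: q)).
  - by apply: leq_ltn_trans sz _; apply: leq_trans lt_q _.
  - have c1 : (c *: q)`_(size q).-1 = 1 by rewrite coefZ mulrC.
    have sE : size (c *: q) = size q.
      apply/eqP; rewrite eqn_leq sz -(@prednK (size q)) ?size_poly_gt0 //.
      by rewrite ltnNge; apply/negP => /leq_sizeP/(_ _ (leqnn _))/eqP; rewrite c1 oner_eq0.
    by rewrite monicE lead_coefE sE c1.
  - split; first exact: poly_inZ.
    by rewrite map_polyZ hornerZ qz mulr0.
move=> nq; exists p; split=> // q qin qz q0; rewrite leqNgt; apply/negP => lt_q.
by apply: nq; exists q.
Qed.

(** Euclidean division by p in R[X]; the second projection of p then divides the
    second projection of q. *)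
Lemma min_poly_vanish z w p q : is_min_poly z p -> ev2 p w = 0 ->
  poly_in q -> ev1 q z = 0 -> ev2 q w = 0.
Proof.
case=> mp pin pz pmin pw; have [n] := ubnP (size q).
elim: n q => // n IHn q; rewrite ltnS => le_n qin qz.
have [->|q0] := eqVneq q 0; first by rewrite rmorph0 horner0.
have lepq := pmin q qin qz q0.
pose r := lead_coef q *: ('X^(size q - size p) * p).
have rin : poly_in r by apply: poly_inZ; [exact: qin | apply: poly_inM].
have rz : ev1 r z = 0 by rewrite map_polyZ rmorphM hornerZ hornerM pz !mulr0.
have rw : ev2 r w = 0 by rewrite map_polyZ rmorphM hornerZ hornerM pw !mulr0.
suff : ev2 (q - r) w = 0 by rewrite rmorphB hornerD hornerN rw subr0.
apply: IHn; last by rewrite rmorphB hornerD hornerN rz qz subr0.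
  apply: leq_trans le_n; have sq : (0 < size q)%N by rewrite size_poly_gt0.
  rewrite -[X in (_ < X)%N](prednK sq) ltnS; apply/leq_sizeP => i le_i.
  have sp : (0 < size p)%N by rewrite size_poly_gt0 monic_neq0.
  rewrite coefB coefZ coefXnM ifF; last first.
    have arith (a b k : nat) : (b.-1 <= k)%N -> (0 < a)%N -> (a <= b)%N -> (k < b - a)%N = false.
      by lia.
    exact: arith le_i sp lepq.
  case: ltngtP le_i => // [lt_i _|<- _].
    have arith (a b k : nat) : (a <= b)%N -> (b.-1 < k)%N -> (b <= k)%N /\ (a <= k - (b - a))%N.
      by lia.
    have [h1 h2] := arith _ _ _ lepq lt_i.
    by rewrite !nth_default ?mulr0 ?subr0.
  have -> : ((size q).-1 - (size q - size p) = (size p).-1)%N.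
    have arith (a b : nat) : (0 < a)%N -> (a <= b)%N -> (b.-1 - (b - a) = a.-1)%N by lia.
    exact: arith.
  by rewrite -!lead_coefE (monicP mp) mulr1 subrr.
exact: poly_inB.
Qed.

(** The extended graph is the evaluation of R[X] at (z, w). *)
Lemma partial_aut_extend z w p : is_min_poly z p -> ev2 p w = 0 ->
  exists R', [/\ partial_aut R', forall x, R x -> R' x & R' (z, w)].
Proof.
move=> hp pw; exists (fun x => exists2 q, poly_in q & x = (ev1 q z, ev2 q w)).
have constE c : R c -> exists2 q, poly_in q & c = (ev1 q z, ev2 q w).
  move=> Rc; exists c%:P; first exact: poly_inC.
  by rewrite !map_polyC !hornerC [LHS]surjective_pairing.
split=> //; last first.
  exists 'X; first by rewrite -['X]expr1; apply: poly_inXn.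
  by rewrite !map_polyX !hornerX.
split=> [a|_ _ [q1 h1 ->] [q2 h2 ->]|_ _ [q1 h1 ->] [q2 h2 ->]|y [q hq [e1 ->]]].
- exact/constE.
- by exists (q1 - q2); [exact: poly_inB | rewrite !rmorphB !hornerD !hornerN].
- by exists (q1 * q2); [exact: poly_inM | rewrite !rmorphM !hornerM].
by apply: (min_poly_vanish hp) => //; rewrite -e1.
Qed.

End PartialAut.

Record gal := Gal {
  gal_fun :> {rmorphism L -> L};
  gal_inv : {rmorphism L -> L};
  galK : cancel gal_fun gal_inv;
  galVK : cancel gal_inv gal_fun;
  gal_fix : forall a, gal_fun (j a) = j a }.

Lemma maximal_partial_aut R0 : partial_aut R0 ->
  exists R, [/\ partial_aut R, forall x, R0 x -> R x &
    forall R', partial_aut R' -> (forall x, R x -> R' x) -> forall x, R' x -> R x].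
Proof.
move=> aut0.
(* The empty graph is let in because Zorn's lemma also considers the union of
   the empty chain. *)
pose P (R : A -> Prop) := (forall x, ~ R x) \/ (partial_aut R /\ forall x, R0 x -> R x).
have [F FP totF|R [PR maxR]] := classical_sets.Zorn_bigcup (P := P).
  case: (boolp.EM (exists2 X, F X & exists x, X x)) => [[X FX [x Xx]]|nF]; last first.
    by left=> x [X FX Xx]; apply: nF; exists X => //; exists x.
  have good Y y : F Y -> Y y -> partial_aut Y /\ forall x, R0 x -> Y x.
    by move=> /FP[h /h|].
  have [[hd _ _ _] h0] := good X x FX Xx.
  have common p q Y Z : F Y -> F Z -> Y p -> Z q -> exists W, [/\ F W, W p, W q & partial_aut W].
    move=> FY FZ Yp Zq; have [autY _] := good _ _ FY Yp; have [autZ _] := good _ _ FZ Zq.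
    by have [YZ|ZY] := totF _ _ FY FZ; [exists Z; split=> //; apply: YZ | exists Y; split=> //; apply: ZY].
  right; split; last by move=> y /h0 Xy; exists X.
  split=> [a|p q [Y FY Yp] [Z FZ Zq]|p q [Y FY Yp] [Z FZ Zq]|y [Y FY Yy]].
  - by exists X.
  - have [W [FW Wp Wq [_ hW _ _]]] := common _ _ _ _ FY FZ Yp Zq.
    by exists W => //; apply: hW.
  - have [W [FW Wp Wq [_ _ hW _]]] := common _ _ _ _ FY FZ Yp Zq.
    by exists W => //; apply: hW.
  by have [[_ _ _ hY] _] := good _ _ FY Yy; apply: hY.
case: PR => [nR|[autR R0R]].
  have R00 : R0 (diag j 0) by case: aut0.
  case: (maxR R0); last by right.
  by split=> [x /nR //|/(_ _ R00)/nR].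
exists R; split=> // R' autR' RR' x R'x; apply: boolp.contrapT => nRx.
apply: (maxR R'); last by right; split=> // y /R0R/RR'.
by split=> // /(_ _ R'x).
Qed.

(** Surjectivity: f permutes the finitely many roots of a polynomial over K. *)
Lemma gal_of_fun (f : {rmorphism L -> L}) :
  (forall a, f (j a) = j a) -> exists s : gal, s =1 f.
Proof.
move=> fj; have surj y : exists x, f x = y.
  have [p p0 py] := algL y.
  have [s es] := closed_field_poly_normal (map_poly j p).
  have lp0 : lead_coef (map_poly j p) != 0 by rewrite lead_coef_eq0 map_poly_eq0.
  have mem_s x : (x \in undup s) = root (map_poly j p) x.
    by rewrite mem_undup es rootZ // root_prod_XsubC.
  have sub : {subset map f (undup s) <= undup s}.
    have ep : map_poly f (map_poly j p) = map_poly j p.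
      by rewrite -map_poly_comp; apply: eq_map_poly => a /=; rewrite fj.
    move=> _ /mapP[x + ->]; rewrite !mem_s -{2}ep fmorph_root //.
  have [||_ e] := uniq_min_size _ sub; last first.
  - have : y \in undup s by rewrite mem_s.
    by rewrite -e => /mapP[x _ ->]; exists x.
  - by rewrite size_map.
  by rewrite map_inj_uniq ?undup_uniq //; apply: fmorph_inj.
have [g gK] := boolp.choice surj.
have fK : cancel f g by move=> x; apply: (fmorph_inj f); rewrite gK.
pose gmul := GRing.isMonoidMorphism.Build L L g (can2_monoid_morphism fK gK).
pose gadd := GRing.isZmodMorphism.Build L L g (can2_zmod_morphism fK gK).
pose g' : {rmorphism L -> L} := HB.pack g gmul gadd.
by exists (@Gal f g' fK gK fj).
Qed.

Lemma gal_of_partial R0 z w : partial_aut R0 -> R0 (z, w) ->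
  exists s : gal, s z = w.
Proof.
move=> aut0 /[dup] R0zw; have [R [autR R0R maxR]] := maximal_partial_aut aut0.
(* A maximal graph is total: a missing x could be sent to a root of the image of
   its minimal polynomial. *)
have total x : exists y, R (x, y).
  have [p hp] := ex_min_poly autR x; have [mp _ px _] := hp.
  have mp2 : map_poly (snd : A -> L) p \is monic.
    exact: (monic_map (snd : {rmorphism A -> L})).
  have sp2 : size (map_poly (snd : A -> L) p) != 1%N.
    have sz (f : {rmorphism A -> L}) : size (map_poly f p) = size p.
      by rewrite size_map_poly_id0 // (monicP mp) rmorph1 oner_eq0.
    apply/eqP => s1; have /eqP/size_poly1P[c c0 e] :
      size (map_poly (fst : {rmorphism A -> L}) p) = 1%N by rewrite sz -s1 sz.
    by move: px; rewrite /= e hornerC => /eqP; rewrite (negPf c0).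
  have [y /rootP py] := closed_rootP _ sp2.
  have [R' [autR' RR' R'xy]] := partial_aut_extend autR hp py.
  by exists y; apply: maxR autR' RR' _ R'xy.
have [f Rf] := boolp.choice total.
have [Rd RB RM R0y] := autR.
have funR x y : R (x, y) -> y = f x.
  move=> Rxy; apply/eqP; rewrite -subr_eq0; apply/eqP/R0y.
  by rewrite -[0](subrr x); apply: (RB (x, y) (x, f x)).
have fB : zmod_morphism f by move=> x y; apply/esym/funR/(RB (x, _) (y, _)).
have fM : monoid_morphism f.
  split=> [|x y]; last by apply/esym/funR/(RM (x, _) (y, _)).
  by have := Rd 1; rewrite rmorph1 => /funR <-.
pose fmul := GRing.isMonoidMorphism.Build L L f fM.
pose fadd := GRing.isZmodMorphism.Build L L f fB.
pose f' : {rmorphism L -> L} := HB.pack f fmul fadd.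
have [|s es] := @gal_of_fun f'; first by move=> a; apply/esym/funR/Rd.
by exists s; rewrite es; apply/esym/funR/R0R.
Qed.

(** If all the roots of the minimal polynomial of z were equal to z, the sum of
    the roots, which is in K, would be a nonzero multiple of z.  So there is another
    root w, and z can be sent to w. *)
Lemma gal_moves z : [pchar K] =i pred0 ->
  (forall a, j a != z) -> exists s : gal, s z != z.
Proof.
move=> char0 nKz.
have aut0 : partial_aut (fun x => exists a, x = diag j a).
  split; first by move=> a; exists a.
  - by move=> _ _ [a ->] [b ->]; exists (a - b); rewrite rmorphB.
  - by move=> _ _ [a ->] [b ->]; exists (a * b); rewrite rmorphM.
  by move=> y [a [-> ->]].
have [p hp] := ex_min_poly aut0 z; have [mp pin pz _] := hp.
have [q eq] : exists q : {poly K}, p = map_poly (diag j) q.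
  have [g eg] := boolp.choice pin; exists (\poly_(i < size p) g i).
  apply/polyP => i; rewrite coef_map coef_poly.
  by case: ltnP => h; [rewrite eg | rewrite nth_default // /= /diag rmorph0].
have e2 : map_poly (snd : A -> L) p = map_poly j q.
  by rewrite eq -map_poly_comp; apply: eq_map_poly.
have e1 : map_poly (fst : A -> L) p = map_poly j q.
  by rewrite eq -map_poly_comp; apply: eq_map_poly.
rewrite e1 in pz.
have mq : map_poly j q \is monic by rewrite -e1; apply: (monic_map (fst : {rmorphism A -> L})).
have [s es] := closed_field_poly_normal (map_poly j q).
rewrite (monicP mq) scale1r in es.
have [/hasP[w ws wz]|nw] := boolP (has (fun w => w != z) s).
  have pw : (map_poly (snd : A -> L) p).[w] = 0.
    by apply/rootP; rewrite e2 es root_prod_XsubC.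
  have [R' [autR' _ R'zw]] := partial_aut_extend aut0 hp pw.
  by have [t tz] := gal_of_partial autR' R'zw; exists t; rewrite tz.
exfalso; have zs : z \in s by rewrite -root_prod_XsubC -es; apply/rootP.
have s0 : (0 < size s)%N by case: (s) zs.
have := coefPn_prod_XsubC (lt0n_neq0 s0); rewrite -es coef_map.
have -> : \sum_(w <- s) w = \sum_(w <- s) z.
  apply: eq_big_seq => w ws; apply/eqP; apply: contraNT nw => wz.
  by apply/hasP; exists w.
rewrite big_const_seq count_predT iter_addr_0 => e.
have n0 : (size s)%:R != 0 :> K.
  by move/pcharf0P: char0 => ->; rewrite -lt0n.
have := nKz (- q`_(size s).-1 / (size s)%:R); rewrite fmorph_div rmorphN /= e opprK.
by rewrite rmorph_nat -[z *+ _]mulr_natr mulfK ?eqxx // -(rmorph_nat j) fmorph_eq0.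
Qed.

Definition stable (Z : seq L) := forall (s : gal) z, z \in Z -> s z \in Z.

Definition agree (Z : seq L) (s t : L -> L) := forall z, z \in Z -> s z = t z.

Lemma ex_stable (Y : seq L) : exists2 Z, {subset Y <= Z} & stable Z.
Proof.
elim: Y => [|y Y [Z YZ stZ]]; first by exists [::].
have [p p0 py] := algL y.
have [r er] := closed_field_poly_normal (map_poly j p).
have lp0 : lead_coef (map_poly j p) != 0 by rewrite lead_coef_eq0 map_poly_eq0.
have mem_r x : (x \in r) = root (map_poly j p) x.
  by rewrite er rootZ // root_prod_XsubC.
exists (r ++ Z) => [x|s z]; rewrite ?inE !mem_cat.
  by case/predU1P => [->|/YZ ->]; rewrite ?mem_r ?py // orbT.
case/orP => [|/stZ ->]; last by rewrite orbT.
have ep : map_poly s (map_poly j p) = map_poly j p.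
  by rewrite -map_poly_comp; apply: eq_map_poly => a /=; rewrite gal_fix.
by rewrite !mem_r => h; rewrite -ep fmorph_root h.
Qed.

(** The automorphisms modulo the pointwise stabilizer of Z form a finite set, as
    they embed in the self-maps of Z. *)
Lemma ex_representatives (Z : seq L) : stable Z ->
  exists (I : finType) (t : I -> gal),
    (forall s : gal, exists i, agree Z s (t i)) /\
    (forall i k, agree Z (t i) (t k) -> i = k).
Proof.
move=> stZ; pose T := {ffun seq_sub Z -> seq_sub Z}.
have code_ok (s : gal) (z : seq_sub Z) : s (val z) \in Z by apply/stZ/valP.
pose code (s : gal) : T := [ffun z => SeqSub (code_ok s z)].
have codeP (s t : gal) : code s = code t <-> agree Z s t.
  split=> [e z zZ|e].
    by move/ffunP/(_ (SeqSub zZ)): e; rewrite !ffunE => -[].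
  by apply/ffunP => z; rewrite !ffunE; apply: val_inj; apply: e; apply: valP.
pose I : finType := {f : T | boolp.asbool (exists s, code s = f)}.
have [t et] : {t : I -> gal & forall i, code (t i) = val i}.
  by apply: (boolp.choice (P := fun (i : I) s => code s = val i)) => i; apply/boolp.asboolP/(valP i).
exists I, t; split=> [s|i k /codeP]; last by rewrite !et => /val_inj.
have h : boolp.asbool (exists t, code t = code s) by apply/boolp.asboolP; exists s.
by exists (exist _ (code s) h); apply/codeP; rewrite et.
Qed.

(** In characteristic zero this is the field generated by K and Z. *)
Definition level (Z : seq L) (x : L) := forall s : gal, agree Z s id -> s x = x.

(** Dedekind's argument: if two coefficients b i and b k are nonzero, choose z in Z
    with t i z <> t k z; subtracting t i z times the relation at x from the relation
    at z * x gives a shorter relation in which b k survives. *)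
Lemma independence (Z : seq L) (I : finType) (t : I -> gal) (b : I -> L) :
  (forall i k, agree Z (t i) (t k) -> i = k) ->
  (forall x, level Z x -> \sum_i b i * t i x = 0) -> forall i, b i = 0.
Proof.
move=> tI; have [n] := ubnP #|[pred i | b i != 0]|.
elim: n b => // n IHn b; rewrite ltnS => le_n sum0 i; apply/eqP; apply: contraT => bi0.
have one_only k : k != i -> b k = 0.
  move=> ki; apply/eqP; apply: contraT => bk0.
  have [z zZ tz] : exists2 z, z \in Z & t k z != t i z.
    apply: boolp.contrapT => h; move/eqP: ki; apply; apply: tI => z zZ.
    by apply/eqP; apply: contraT => hz; case: h; exists z.
  have /eqP : b k * (t k z - t i z) = 0.
    apply: (IHn (fun l => b l * (t l z - t i z))).
      apply: leq_trans le_n; apply: proper_card; apply/properP; split.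
        by apply/subsetP => l; rewrite !inE; apply: contraNneq => ->; rewrite mul0r.
      by exists i; rewrite !inE ?subrr ?mulr0 ?eqxx.
    move=> x lx; under eq_bigr do rewrite mulrBr mulrBl.
    rewrite sumrB.
    have lz : level Z z by move=> s /(_ z zZ).
    have lzx : level Z (z * x) by move=> s hs; rewrite rmorphM lz // lx.
    have := sum0 _ lzx; under eq_bigr do rewrite rmorphM mulrA.
    move=> ->; under eq_bigr do rewrite mulrAC mulrC.
    by rewrite -mulr_sumr sum0 // mulr0 subr0.
  by rewrite mulf_eq0 subr_eq0 (negPf bk0) (negPf tz).
have l1 : level Z 1 by move=> s _; rewrite rmorph1.
have := sum0 1 l1; rewrite (bigD1 i) //= rmorph1 mulr1 big1 ?addr0.
  by move=> h; rewrite h eqxx in bi0.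
by move=> k /one_only ->; rewrite mul0r.
Qed.

End Extension.

(** * Galois descent *)

Section GalGroup.
Variables (K : fieldType) (L : closedFieldType) (j : {rmorphism K -> L}).
Implicit Types s t : gal j.

Fact galV_fix s a : gal_inv s (j a) = j a.
Proof. by rewrite -{1}(gal_fix s a) (galK s). Qed.

Definition galV s : gal j := Gal (@galVK _ _ _ s) (@galK _ _ _ s) (galV_fix s).

Fact galM_fix s t a : s (t (j a)) = j a.
Proof. by rewrite !gal_fix. Qed.

Fact galM_K s t : cancel (s \o t) (gal_inv t \o gal_inv s).
Proof. by move=> x /=; rewrite (galK s) (galK t). Qed.

Fact galM_VK s t : cancel (gal_inv t \o gal_inv s) (s \o t).
Proof. by move=> x /=; rewrite (galVK t) (galVK s). Qed.

Definition galM s t : gal j :=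
  @Gal _ _ j (s \o t) (gal_inv t \o gal_inv s) (@galM_K s t) (@galM_VK s t) (galM_fix s t).

Fact gal1_fix a : (idfun : {rmorphism L -> L}) (j a) = j a.
Proof. by []. Qed.

Definition gal1 : gal j :=
  @Gal _ _ j idfun idfun (fun=> erefl) (fun=> erefl) gal1_fix.

Lemma level_agree Z s t x : level j Z x -> agree Z s t -> s x = t x.
Proof.
move=> lx st; apply: (can_inj (galVK t)) => /=; rewrite (galK t).
by apply: (lx (galM (galV t) s)) => z zZ /=; rewrite st // (galK t).
Qed.

Lemma level_mem Z z : z \in Z -> level j Z z.
Proof. by move=> zZ s /(_ z zZ). Qed.

Section Reps.
Variables (Z : seq L) (I : finType) (t : I -> gal j).
Hypotheses (stZ : stable j Z) (tsurj : forall s : gal j, exists i, agree Z s (t i)).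
Hypothesis tinj : forall i k, agree Z (t i) (t k) -> i = k.

(** Left multiplication by s acts on the classes modulo the stabilizer of Z. *)
Lemma gal_permutes s :
  exists pi : {perm I}, forall i, agree Z (galM s (t i)) (t (pi i)).
Proof.
have [f hf] := boolp.choice (fun i => tsurj (galM s (t i))).
have f_inj : injective f.
  move=> i k e; apply: tinj => z zZ; apply: (can_inj (galK s)).
  by have := hf i z zZ; rewrite /= e -(hf k z zZ).
by exists (perm f_inj) => i; rewrite permE; apply: hf.
Qed.

Lemma trace_fixed s x : level j Z x -> s (\sum_i t i x) = \sum_i t i x.
Proof.
move=> lx; have [pi hpi] := gal_permutes s.
rewrite rmorph_sum [RHS](reindex_inj (@perm_inj _ pi)); apply: eq_bigr => i _ /=.
exact: (level_agree (s := galM s (t i)) lx (hpi i)).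
Qed.

End Reps.

Lemma map_mxVK s n (v : 'rV[L]_n) : map_mx s (map_mx (galV s) v) = v.
Proof. by apply/rowP => i; rewrite !mxE (galVK s). Qed.

Lemma map_mxKV s n (v : 'rV[L]_n) : map_mx (galV s) (map_mx s v) = v.
Proof. by apply/rowP => i; rewrite !mxE (galK s). Qed.

Lemma map_mxM_gal s t n (v : 'rV[L]_n) : map_mx (galM s t) v = map_mx s (map_mx t v).
Proof. by apply/rowP => i; rewrite !mxE. Qed.

Lemma map_row_neq0 s n (v : 'rV[L]_n) : v != 0 -> map_mx s v != 0.
Proof.
by apply: contraNneq => h; rewrite -(map_mxKV s v) h map_mx0.
Qed.

Definition twist s m n (F : 'I_m -> {mpoly L[n]}) i : {mpoly L[n]} := map_mpoly s (F i).

Lemma ev_map s n (p : {mpoly L[n]}) v : ev (map_mpoly s p) (map_mx s v) = s (ev p v).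
Proof.
pose f : {rmorphism {mpoly L[n]} -> L} :=
  meval (fun i => (map_mx s v) 0 i) \o map_mpoly s.
pose g : {rmorphism {mpoly L[n]} -> L} := s \o meval (fun i => v 0 i).
apply: (mpoly_rmorph_ext (f := f) (g := g)) => [c|i] /=.
  by rewrite map_mpolyC !mevalC.
by rewrite map_mpolyX !mevalXU mxE.
Qed.

Lemma evs_twist s m n (F : 'I_m -> {mpoly L[n]}) v :
  evs (twist s F) (map_mx s v) = map_mx s (evs F v).
Proof. by apply/rowP => i; rewrite !mxE ev_map. Qed.

Lemma twist_homog s m n (F : 'I_m -> {mpoly L[n]}) d i :
  F i \is d.-homog -> twist s F i \is d.-homog.
Proof.
by move=> /dhomogP h; apply/dhomogP => m0; rewrite (perm_mem (msupp_map_mpoly _ (fmorph_inj s))) => /h.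
Qed.

Lemma map_mpoly_ext s n (p : {mpoly K[n]}) : map_mpoly s (map_mpoly j p) = map_mpoly j p.
Proof. by apply/mpolyP => m; rewrite !mcoeff_map_mpoly /= (gal_fix s). Qed.

Lemma twist_ext s m n (F : 'I_m -> {mpoly K[n]}) i : twist s (ext_forms j F) i = ext_forms j F i.
Proof. exact: map_mpoly_ext. Qed.

Lemma evs_ext s m n (F : 'I_m -> {mpoly K[n]}) v :
  evs (ext_forms j F) (map_mx s v) = map_mx s (evs (ext_forms j F) v).
Proof. by rewrite -evs_twist; apply/rowP => i; rewrite !mxE twist_ext. Qed.

Lemma gal_point_ex s X (x : gpoint j X) :
  exists y : gpoint j X, forall v, rep v x -> rep (map_mx s v) y.
Proof.
have vx := rep_hcoord x; have /allP onx := rep_onvar vx.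
have [|y hy] := @rep_make _ _ j X _ (map_row_neq0 s vx.1).
  apply/allP => p pX; have /eqP h := onx p pX.
  have := ev_map s (map_mpoly j p) (hcoord (val x)); rewrite map_mpoly_ext => e.
  by apply/eqP; apply: etrans e (etrans (congr1 s h) (rmorph0 s)).
exists y => v vx'; have [c c0 ->] := rep_prop vx vx'.
by rewrite map_mxZ; apply: rep_scale hy; rewrite fmorph_eq0.
Qed.

(** The action of s on the L-points of X, through homogeneous coordinates; it is
    well defined because the equations of X have coefficients in K. *)
Definition galact s X (x : gpoint j X) : gpoint j X := sval (boolp.cid (gal_point_ex s x)).

Lemma galactP s X (x : gpoint j X) v : rep v x -> rep (map_mx s v) (galact s x).
Proof. exact: (svalP (boolp.cid (gal_point_ex s x))). Qed.

Lemma galact_VK s X (x : gpoint j X) : galact s (galact (galV s) x) = x.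
Proof.
apply: (@rep_inj _ _ _ _ (hcoord (val x))); last exact: rep_hcoord.
by rewrite -(map_mxVK s (hcoord _)); do 2!apply: galactP; apply: rep_hcoord.
Qed.

Lemma galactVK s X (x : gpoint j X) : galact (galV s) (galact s x) = x.
Proof.
apply: (@rep_inj _ _ _ _ (hcoord (val x))); last exact: rep_hcoord.
by rewrite -(map_mxKV s (hcoord _)); do 2!apply: galactP; apply: rep_hcoord.
Qed.

Lemma galactM s t X (x : gpoint j X) : galact (galM s t) x = galact s (galact t x).
Proof.
apply: (@rep_inj _ _ _ _ (map_mx (galM s t) (hcoord (val x)))).
  exact/galactP/rep_hcoord.
by rewrite map_mxM_gal; do 2!apply: galactP; apply: rep_hcoord.
Qed.

Lemma regular_equivariant X Y (f : gpoint j X -> gpoint j Y) s x :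
  regular f -> f (galact s x) = galact s (f x).
Proof.
move=> /regularP rf; have vx := rep_hcoord x.
have [d [F [hF Fv Fy]]] := rf x _ vx.
apply: rep_inj (Fy _ _ (galactP s vx) _) _; rewrite evs_ext.
  exact: map_row_neq0.
by apply: galactP; apply: Fy.
Qed.

Lemma lregular_conj X Y (f : gpoint j X -> gpoint j Y) s :
  lregular f -> lregular (fun x => galact s (f (galact (galV s) x))).
Proof.
move=> rf x v vx; have [d [F [hF Fv Fy]]] := rf _ _ (galactP (galV s) vx).
exists d, (twist s F); split=> [i||y w wy].
- exact: twist_homog.
- by rewrite -(map_mxVK s v) evs_twist map_row_neq0.
rewrite -(map_mxVK s w) evs_twist => Fw; apply: galactP; apply: Fy.
  exact: galactP.
by apply: contraNneq Fw => ->; rewrite map_mx0.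
Qed.

End GalGroup.

Section Descent.
Variables (K : fieldType) (L : closedFieldType) (j : {rmorphism K -> L}).
Hypothesis algL : algebraic_closure j.
Hypothesis char0 : [pchar K] =i pred0.

Lemma gal_fixed z : (forall s : gal j, s z = z) -> exists a, j a = z.
Proof.
move=> fz; apply: boolp.contrapT => nz.
have [|s] := gal_moves algL char0 (z := z); last by rewrite fz eqxx.
by move=> a; apply/eqP => e; apply: nz; exists a.
Qed.

Lemma mpoly_descent n (p : {mpoly L[n]}) :
  (forall m (s : gal j), s p@_m = p@_m) -> exists q : {mpoly K[n]}, map_mpoly j q = p.
Proof.
move=> fp; have [g hg] := boolp.choice (fun m => gal_fixed (fp m)).
exists (\sum_(m <- msupp p) g m *: 'X_[m]); rewrite rmorph_sum [RHS]mpolyE.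
by apply: eq_bigr => m _ /=; rewrite map_mpolyZ map_mpolyX hg.
Qed.

(** Let F be forms over L describing f near x.  By equivariance each conjugate of F
    also describes f wherever it does not vanish.  So does the trace of c * F, whose
    coefficients are in K, and by independence of automorphisms some c makes it
    nonzero at x. *)
Theorem regular_descent X Y (f : gpoint j X -> gpoint j Y) :
  lregular f -> (forall (s : gal j) x, f (galact s x) = galact s (f x)) -> regular f.
Proof.
move=> rf feq; apply/regularP => x v vx; have [d [F [hF Fv Fy]]] := rf x v vx.
have [Z FZ stZ] := ex_stable algL
  (flatten [seq [seq (F i)@_m | m <- msupp (F i)] | i <- enum 'I_(pv_dim Y).+1]).
have coefZ i m : level j Z (F i)@_m.
  have [mF|/memN_msupp_eq0 -> s _] := boolP (m \in msupp (F i)); last exact: rmorph0.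
  apply/level_mem/FZ/flatten_mapP; exists i; first by rewrite mem_enum.
  by apply/mapP; exists m.
have [I [t [tsurj tinj]]] := ex_representatives stZ.
have twist_line k y w : rep w y -> evs (twist (t k) F) w != 0 ->
    rep (evs (twist (t k) F) w) (f y).
  move=> wy; rewrite -(map_mxVK (t k) w) evs_twist => Fw.
  have -> : f y = galact (t k) (f (galact (galV (t k)) y)) by rewrite -feq galact_VK.
  apply: galactP; apply: Fy; first exact: galactP.
  by apply: contraNneq Fw => ->; rewrite map_mx0.
have /rV0Pn[i0 Fi0] := Fv.
have [c lc cv] : exists2 c, level j Z c & \sum_k evs (twist (t k) F) v 0 i0 * t k c != 0.
  apply: boolp.contrapT => h; have [k hk] := tsurj (gal1 j).
  have : evs (twist (t k) F) v 0 i0 = 0.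
    apply: (independence (j := j) (Z := Z) (t := t)
      (b := fun k => evs (twist (t k) F) v 0 i0)) => // c lc.
    by apply/eqP; apply: contraT => hc; case: h; exists c.
  have -> : evs (twist (t k) F) v = evs F v; last by apply/eqP.
  apply/rowP => i; rewrite !mxE; congr (ev _ _); apply/mpolyP => m.
  by rewrite mcoeff_map_mpoly; apply/esym/(level_agree (s := gal1 j) (coefZ i m) hk).
(* The trace of c * F. *)
pose G i := \sum_k t k c *: twist (t k) F i.
have [q eq] : exists q : 'I_(pv_dim Y).+1 -> {mpoly K[(pv_dim X).+1]}, forall i, map_mpoly j (q i) = G i.
  apply: (fin_all_exists (P := fun i q => map_mpoly j q = G i)) => i.
  apply: mpoly_descent => m s.
  have -> : (G i)@_m = \sum_k t k (c * (F i)@_m).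
    rewrite /G raddf_sum; apply: eq_bigr => k _ /=.
    by rewrite mcoeffZ mcoeff_map_mpoly rmorphM.
  apply: trace_fixed tsurj tinj s _ _ => s hs.
  by rewrite rmorphM lc // coefZ.
have evG w : evs (ext_forms j q) w = \sum_k t k c *: evs (twist (t k) F) w.
  apply/rowP => i; rewrite summxE !mxE /ext_forms eq /ev raddf_sum; apply: eq_bigr => k _ /=.
  by rewrite mevalZ !mxE.
exists d, q; split=> [i||y w wy Gw].
- rewrite -(ext_homog j) /ext_forms eq; apply: rpred_sum => k _; apply: rpredZ.
  exact: twist_homog.
- apply/rV0Pn; exists i0; rewrite evG summxE; apply: contraNneq cv => e.
  by rewrite -[X in _ == X]e; apply/eqP/eq_bigr => k _; rewrite !mxE mulrC.
have uy := rep_hcoord (f y); have [a ea] : exists a, evs (ext_forms j q) w = a *: hcoord (val (f y)).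
  have h k : exists a, evs (twist (t k) F) w = a *: hcoord (val (f y)).
    have [->|/(twist_line k y w wy) r] := eqVneq (evs (twist (t k) F) w) 0.
      by exists 0; rewrite scale0r.
    by have [a _ ->] := rep_prop uy r; exists a.
  have [g hg] := boolp.choice h; exists (\sum_k t k c * g k).
  by rewrite evG scaler_suml; apply: eq_bigr => k _; rewrite hg scalerA.
rewrite ea in Gw *; apply: rep_scale uy.
by apply: contraNneq Gw => ->; rewrite scale0r.
Qed.

End Descent.

(** * Forms of projective space with a rational point *)

Section Frame.
Variables (L : fieldType) (n : nat).

(** The standard projective frame: its points have coordinates in the prime field,
    and a linear map is determined up to a scalar by its values on them. *)
Definition frame (o : option 'I_n) : 'rV[L]_n :=
  if o is Some k then delta_mx 0 k else const_mx 1.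

Lemma frame_scalar (M : 'M[L]_n) :
  (forall o, exists c, frame o *m M = c *: frame o) -> exists c, M = c%:M.
Proof.
move=> hM; have [d hd] := boolp.choice (fun k => hM (Some k)).
have [c hc] := hM None; exists c; apply/row_matrixP => k.
rewrite !rowE hd mul_mx_scalar; congr (_ *: _).
have := congr1 (fun v : 'rV[L]_n => v 0 k) hc; rewrite /frame !mxE mulr1 => <-.
rewrite (bigD1 k) //= big1 => [|i ik]; rewrite mxE mul1r.
  have := congr1 (fun v : 'rV[L]_n => v 0 k) (hd k).
  by rewrite -rowE !mxE !eqxx mulr1 addr0 => ->.
have := congr1 (fun v : 'rV[L]_n => v 0 k) (hd i).
by rewrite -rowE !mxE eq_sym (negPf ik) andbF mulr0.
Qed.

Lemma frame_proportional (A B : 'M[L]_n) : B \in unitmx ->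
  (forall o, exists c, frame o *m A = c *: (frame o *m B)) -> exists c, A = c *: B.
Proof.
move=> uB h; have [o|c e] := @frame_scalar (A *m invmx B).
  by have [c hc] := h o; exists c; rewrite mulmxA hc -scalemxAl mulmxK.
by exists c; rewrite -mul_scalar_mx -e mulmxKV.
Qed.

(** A maximal independent family in V spans, for otherwise a nonzero linear form
    vanishes on it and some vector of V can be added. *)
Lemma basis_of_separating (V : 'rV[L]_n -> Prop) :
  (forall u : 'cV[L]_n, u != 0 -> exists2 x, V x & x *m u != 0) ->
  exists2 B : 'M[L]_n, B \in unitmx & forall k, V (row k B).
Proof.
move=> hV; suff indep r : (r <= n)%N ->
    exists2 B : 'M[L]_(r, n), row_free B & forall k, V (row k B).
  by have [B fB VB] := indep n (leqnn n); exists B; rewrite // -row_free_unit.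
elim: r => [_|r IHr lt_r]; first by exists 0; [rewrite /row_free mxrank0 | case].
have [B fB VB] := IHr (ltnW lt_r).
have [u u0 Bu] : exists2 u : 'cV[L]_n, u != 0 & B *m u = 0.
  have : cokermx B != 0.
    by rewrite -mxrank_eq0 mxrank_coker (eqP fB) subn_eq0 -ltnNge.
  case/matrix0Pn => i [k Cik]; exists (col k (cokermx B)).
    by apply/matrix0Pn; exists i, 0; rewrite mxE.
  by rewrite colE mulmxA mulmx_coker mul0mx.
have [x Vx xu] := hV u u0.
rewrite -addn1; exists (col_mx B x).
  apply: inj_row_free => v.
  rewrite -[v]hsubmxK mul_row_col => e.
  have e2 : rsubmx v *m (x *m u) = 0.
    by move/(congr1 (mulmx^~ u)): e; rewrite mulmxDl -!mulmxA Bu mulmx0 add0r mul0mx.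
  have r0 : rsubmx v = 0.
    move: e2; rewrite [x *m u]mx11_scalar mul_mx_scalar => /eqP.
    rewrite scaler_eq0 => /orP[/eqP h|/eqP //].
    by move: xu; rewrite [x *m u]mx11_scalar h raddf0 eqxx.
  move: e; rewrite r0 mul0mx addr0 => /eqP; rewrite mulmx_free_eq0 // => /eqP ->.
  by rewrite row_mx0.
move=> k; rewrite -(splitK k); case: (split k) => l /=.
  by rewrite rowKu.
rewrite rowKd (_ : row l x = x) //.
by apply/rowP => i; rewrite !mxE ord1.
Qed.

End Frame.

Section Chatelet.
Variables (K : fieldType) (L : closedFieldType) (j : {rmorphism K -> L}).
Hypothesis algL : algebraic_closure j.
Hypothesis char0 : [pchar K] =i pred0.

Local Notation prep n := (@rep K L j (pn K n)).

Lemma linear_map n (M : 'M[L]_n.+1) : M \in unitmx ->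
  exists2 f : gpoint j (pn K n) -> gpoint j (pn K n), lregular f &
    forall v x, prep n v x -> prep n (v *m M) (f x).
Proof.
move=> uM; have ex x : exists y, forall v, prep n v x -> prep n (v *m M) y.
  have vx := rep_hcoord x; have vM0 : (hcoord (val x) : 'rV_n.+1) *m M != 0.
    by apply: contraNneq vx.1 => h; rewrite -[hcoord _](mulmxK uM) h mul0mx.
  have [y hy] := rep_pn j vM0; exists y => v vx'.
  have [c c0 ->] := rep_prop vx vx'; rewrite -scalemxAl.
  exact: (@rep_scale _ _ j (pn K n)).
have [f hf] := boolp.choice ex; exists f => [x v vx|v x]; last exact: hf.
pose F k : {mpoly L[n.+1]} := \sum_i M i k *: 'X_i.
have evF w : evs F w = w *m M.
  apply/rowP => k; rewrite !mxE /ev raddf_sum; apply: eq_bigr => i _ /=.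
  by rewrite mevalZ mevalXU mulrC.
exists 1%N, F; split=> [k||y w wy _]; rewrite ?evF; last exact: hf.
  by apply: rpred_sum => i _; apply: rpredZ; rewrite dhomogX /= mdeg1.
exact: (hf _ _ vx).1.
Qed.

Section Form.
Variables (n : nat) (X : projvar K).
Variables (phi : gpoint j X -> gpoint j (pn K n.+1)) (psi : gpoint j (pn K n.+1) -> gpoint j X).
Hypotheses (phi_reg : lregular phi) (psi_reg : lregular psi).
Hypotheses (phiK : cancel phi psi) (psiK : cancel psi phi).

Local Notation prp := (prep n.+1).

(** On projective space, the Galois action transported from X is v |-> v^s M. *)
Definition twisting (s : gal j) (M : 'M[L]_n.+2) :=
  M \in unitmx /\ forall v x, prp v x -> prp (map_mx s v *m M) (phi (galact s (psi x))).

(** The transported action of s, composed with the inverse of the natural one, is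
    a regular automorphism of projective space over L. *)
Lemma ex_twisting s : exists M, twisting s M.
Proof.
pose c := phi \o (fun x => galact s (psi (galact (galV s) x))).
pose d := (fun x => galact s (phi (galact (galV s) x))) \o psi.
have [|||M uM hM] := @automorphism_pn_linear K L j n c d.
- by apply: lregular_comp phi_reg; apply: lregular_conj.
- by apply: lregular_comp psi_reg _; apply: lregular_conj.
- by move=> x; rewrite /c /d /= phiK galactVK psiK galact_VK.
exists M; split=> // v x vx.
by have := hM _ _ (galactP s vx); rewrite /c /= galactVK.
Qed.

Lemma frame_neq0 o : frame L (n := n.+2) o != 0.
Proof.
apply/rV0Pn; case: o => [k|]; first by exists k; rewrite mxE !eqxx oner_eq0.
by exists 0; rewrite mxE oner_eq0.
Qed.

Lemma map_frame (s : {rmorphism L -> L}) o : map_mx s (frame L (n := n.+2) o) = frame L o.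
Proof.
case: o => [k|] /=; first by rewrite map_delta_mx.
by apply/rowP => i; rewrite !mxE rmorph1.
Qed.

Lemma twisting_unique s M N : twisting s M -> twisting s N -> exists c, M = c *: N.
Proof.
move=> [uM hM] [uN hN]; apply: frame_proportional => // o.
have [x ox] := rep_pn j (frame_neq0 o).
have [c _ e] := rep_prop (hN _ _ ox) (hM _ _ ox).
by exists c; rewrite !map_frame in e.
Qed.

Lemma twistingM s t M N : twisting s M -> twisting t N ->
  twisting (galM s t) (map_mx s N *m M).
Proof.
move=> [uM hM] [uN hN]; split; first by rewrite unitmx_mul uM andbT map_unitmx.
move=> v x vx; have := hM _ _ (hN _ _ vx).
by rewrite phiK -galactM map_mxM mulmxA map_mxM_gal.
Qed.

Lemma galact_ext (s t : gal j) Y (x : gpoint j Y) : s =1 t -> galact s x = galact t x.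
Proof.
move=> st; have vx := rep_hcoord x; apply: rep_inj (galactP s vx) _.
have -> : map_mx s (hcoord (val x)) = map_mx t (hcoord (val x)) by apply/eq_map_mx.
exact: galactP.
Qed.

Lemma twistingZ s c M : c != 0 -> twisting s M -> twisting s (c *: M).
Proof.
move=> c0 [uM hM]; split; first by rewrite unitmxZ ?unitfE.
move=> v x vx; rewrite -scalemxAr.
by apply: (@rep_scale _ _ j (pn K n.+1)) => //; apply: hM.
Qed.

Section RationalPoint.
Variable p0 : gpoint j X.
Hypothesis fix0 : forall s : gal j, galact s p0 = p0.

Let v0 : 'rV[L]_n.+2 := hcoord (val (phi p0)).
Let v0P : prp v0 (phi p0). Proof. exact: rep_hcoord. Qed.

(** The fixed point removes the scalar ambiguity of M: normalized matrices form a
    cocycle with values in GL, not merely in PGL. *)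
Definition normalized s M := twisting s M /\ map_mx s v0 *m M = v0.

Lemma ex_normalized s : exists M, normalized s M.
Proof.
have [M tM] := ex_twisting s; have := tM.2 _ _ v0P.
rewrite phiK fix0 => /(rep_prop v0P)[c c0 e].
exists (c^-1 *: M); split; first by apply: twistingZ => //; rewrite invr_neq0.
by rewrite -scalemxAr e scalerK.
Qed.

Lemma normalized_unique s M N : normalized s M -> normalized s N -> M = N.
Proof.
move=> [tM hM] [tN hN]; have [c e] := twisting_unique tM tN.
rewrite e -scalemxAr hN in hM; rewrite e; suff -> : c = 1 by rewrite scale1r.
have /rV0Pn[k v0k] := v0P.1; apply: (mulIf v0k); rewrite mul1r.
by rewrite -[in RHS]hM mxE.
Qed.

Lemma normalizedM s t M N : normalized s M -> normalized t N ->
  normalized (galM s t) (map_mx s N *m M).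
Proof.
move=> [tM hM] [tN hN]; split; first exact: twistingM.
by rewrite mulmxA map_mxM_gal -map_mxM hN hM.
Qed.

Lemma normalized_ext (s t : gal j) M : s =1 t -> normalized s M -> normalized t M.
Proof.
move=> st [[uM hM] h0]; have e m (v : 'rV[L]_m) : map_mx s v = map_mx t v.
  by apply/rowP => i; rewrite !mxE st.
split; last by rewrite -e.
by split=> // v x vx; rewrite -e -(galact_ext _ st); apply: hM.
Qed.

Let row_seq m (v : 'rV[L]_m) := [seq v 0 i | i <- enum 'I_m].

Let agree_row Z (s : gal j) m (v : 'rV[L]_m) :
  agree Z s id -> {subset row_seq v <= Z} -> map_mx s v = v.
Proof.
move=> sZ vZ; apply/rowP => i; rewrite mxE; apply/sZ/vZ.
by apply: map_f; rewrite mem_enum.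
Qed.

(** Z contains the coordinates of v0 and of the points of X corresponding to the
    frame.  If s fixes Z, then M fixes the frame, so it is scalar, and it fixes v0.
    This is the continuity of the cocycle. *)
Lemma ex_level : exists2 Z, stable j Z &
  forall s : gal j, agree Z s id -> map_mx s v0 = v0 /\ normalized s 1%:M.
Proof.
have [y hy] := boolp.choice (fun o => rep_pn j (frame_neq0 o)).
pose w o : 'rV[L]_(pv_dim X).+1 := hcoord (val (psi (y o))).
have [Z YZ stZ] := ex_stable algL
  (row_seq v0 ++ flatten [seq row_seq (w o) | o <- enum {: option 'I_n.+2}]).
exists Z => // s sZ.
have v0s : map_mx s v0 = v0.
  by apply: (agree_row sZ) => x xv; apply: YZ; rewrite mem_cat xv.
have ws o : galact s (psi (y o)) = psi (y o).
  have wo := rep_hcoord (psi (y o)); apply: (rep_inj _ wo).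
  rewrite -[X in rep X _](agree_row (s := s) sZ); first exact: galactP wo.
  move=> x xw; apply: YZ; rewrite mem_cat; apply/orP; right.
  by apply/flatten_mapP; exists o; rewrite ?mem_enum.
split=> //; have [M [[uM hM] h0]] := ex_normalized s.
suff -> : 1%:M = M by split.
have [o|c ec] := frame_scalar (M := M).
  have := hM _ _ (hy o); rewrite map_frame ws psiK => /(rep_prop (hy o))[c _ e].
  by exists c.
have /rV0Pn[k v0k] := v0P.1; rewrite ec v0s mul_mx_scalar in h0.
rewrite ec; congr (_%:M); apply: (mulIf v0k); rewrite mul1r.
by rewrite -[in LHS]h0 mxE.
Qed.

(** Hilbert 90 for GL: averaging a vector over the Galois group makes it invariant,
    and independence of automorphisms shows that no nonzero linear form vanishes on
    all the averages. *)
Lemma ex_invariant_basis : exists2 B : 'M[L]_n.+2, B \in unitmx &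
  forall (s : gal j) M, normalized s M -> map_mx s B *m M = B.
Proof.
have [C hC] := boolp.choice ex_normalized.
have [Z stZ levZ] := ex_level.
have [I [t [tsurj tinj]]] := ex_representatives stZ.
have C_agree (s s' : gal j) : agree Z s s' -> C s = C s'.
  move=> ss'; pose r := galM (galV s) s'.
  have rZ : agree Z r id by move=> z zZ; rewrite /= -ss' // (galK s).
  have [_ n1] := levZ r rZ; apply: (@normalized_unique s') => //.
  apply: (@normalized_ext (galM s r)); first by move=> x /=; rewrite (galVK s).
  by rewrite -[C s]mul1mx -(map_mx1 s); apply: normalizedM.
have CM s s' : C (galM s s') = map_mx s (C s') *m C s.
  by apply: normalized_unique (hC _) _; apply: normalizedM.
(* The average of x over the classes of automorphisms modulo the stabilizer of Z. *)
pose w (x : 'rV[L]_n.+2) := \sum_i map_mx (t i) x *m C (t i).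
pose lev (x : 'rV[L]_n.+2) := forall k, level j Z (x 0 k).
have w_inv (s : gal j) x : lev x -> map_mx s (w x) *m C s = w x.
  move=> lx; have [pi hpi] := gal_permutes tsurj tinj s.
  rewrite raddf_sum mulmx_suml [RHS](reindex_inj (@perm_inj _ pi)).
  apply: eq_bigr => i _ /=; rewrite map_mxM -mulmxA -CM (C_agree _ _ (hpi i)).
  congr (_ *m _); apply/rowP => k; rewrite !mxE.
  exact: (level_agree (s := galM s (t i)) (lx k) (hpi i)).
have [u u0|B uB hB] := @basis_of_separating L n.+2 (fun y => exists2 x, lev x & y = w x).
  apply: boolp.contrapT => h; case/eqP: u0.
  have Cu i : C (t i) *m u = 0.
    apply/colP => k; rewrite [in RHS]mxE.
    apply: (independence (j := j) (Z := Z) (t := t) (b := fun i => (C (t i) *m u) k 0)) => // c lc.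
    apply/eqP; apply: contraT => hc; case: h.
    exists (w (c *: delta_mx 0 k)).
      exists (c *: delta_mx 0 k) => // l s sZ.
      by rewrite !mxE rmorphM (lc s sZ) rmorph_nat.
    have e : (w (c *: delta_mx 0 k) *m u) 0 0 = \sum_i (C (t i) *m u) k 0 * t i c.
      rewrite mulmx_suml summxE; apply: eq_bigr => l _.
      rewrite map_mxZ map_delta_mx -mulmxA -scalemxAl -rowE.
      by rewrite [LHS]mxE [X in _ * X]mxE mulrC.
    by apply: contraNneq hc => h0; rewrite -e h0 mxE.
  have [i _] := tsurj (gal1 j).
  have [[ut _] _] := hC (t i).
  by rewrite -[u](mulKmx ut) Cu mulmx0.
exists B => // s M nM; rewrite (normalized_unique nM (hC s)).
apply/row_matrixP => k; rewrite row_mul -map_row.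
by have [x lx ->] := hB k; apply: w_inv.
Qed.

(** Châtelet's theorem.  In the coordinates given by an invariant basis B the
    maps phi and psi commute with the Galois action, so they descend to K. *)
Theorem rational_point_split : isomorphic j X (pn K n.+1).
Proof.
have [B uB hB] := ex_invariant_basis.
have uB' : invmx B \in unitmx by rewrite unitmx_inv.
have [f f_reg hf] := linear_map uB'; have [g g_reg hg] := linear_map uB.
have fgK : cancel f g.
  move=> x; have vx := rep_hcoord x; apply: (rep_inj _ vx).
  by have := hg _ _ (hf _ _ vx); rewrite mulmxKV.
have gfK : cancel g f.
  move=> x; have vx := rep_hcoord x; apply: (rep_inj _ vx).
  by have := hf _ _ (hg _ _ vx); rewrite mulmxK.
have equiv (s : gal j) x : (f \o phi) (galact s x) = galact s ((f \o phi) x).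
  have vx := rep_hcoord (phi x).
  have [M nM] := ex_normalized s; have := hf _ _ (nM.1.2 _ _ vx).
  rewrite phiK => h; apply: rep_inj h _; have := galactP s (hf _ _ vx).
  rewrite map_mxM; suff -> : map_mx s (invmx B) = M *m invmx B by rewrite mulmxA.
  have uBs : map_mx s B \in unitmx by rewrite map_unitmx.
  apply: (can_inj (mulKmx uBs)).
  by rewrite mulmxA (hB s M nM) -map_mxM !mulmxV // map_mx1.
exists (f \o phi); split.
  by apply: (regular_descent algL char0) => //; apply: lregular_comp.
exists (psi \o g); split.
- apply: (regular_descent algL char0); first exact: lregular_comp.
  move=> s x /=; apply: (can_inj phiK); apply: (can_inj fgK).
  have := equiv s (psi (g x)); rewrite /= !psiK gfK => ->.
  by rewrite gfK.
- by move=> x /=; rewrite fgK phiK.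
- by move=> x /=; rewrite psiK gfK.
Qed.

End RationalPoint.
End Form.
End Chatelet.

(** * Finite groups *)

Lemma exponent3_pgroup (gT : finGroupType) :
  (forall g : gT, (g ^+ 3 = 1)%g) -> 3.-group%g [set: gT].
Proof.
move=> e3; apply/pgroupP => p pp /(Cauchy pp)[x _ ox].
have : (#[x]%g %| 3)%N by rewrite order_dvdn e3.
by rewrite ox inE dvdn_prime2.
Qed.

Lemma small_exponent3_isog (gT : finGroupType) :
  (forall g : gT, (g ^+ 3 = 1)%g) -> (#|gT| <= 9)%N ->
  exists H : {group 'Z_3 * 'Z_3}, [set: gT]%G \isog H.
Proof.
move=> e3 le9; have pG := exponent3_pgroup e3.
have [k oG] : exists k, #|gT| = (3 ^ k)%N.
  by have [k] := p_natP pG; rewrite cardsT; exists k.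
have k2 : (k <= 2)%N by rewrite -(@leq_exp2l 3) // -oG.
have logG : logn 3 #|[set: gT]| = k by rewrite cardsT oG pfactorK.
have abG : 3.-abelem%g [set: gT]%G.
  rewrite abelemE // (p2group_abelian pG) ?logG //.
  by apply/exponentP => g _; apply: e3.
have eZ (x : 'Z_3 * 'Z_3) : (x ^+ 3 = 1)%g.
  by case: x => [[[|[|[|m]]] // ?] [[|[|[|l]]] // ?]]; apply/eqP.
have pZ := exponent3_pgroup eZ.
have oZ : #|[set: 'Z_3 * 'Z_3]| = 9%N by rewrite cardsT card_prod !card_ord.
have [|H [_ _ oH]] := normal_pgroup (r := k) pZ (normal_refl _).
  by rewrite oZ.
exists H; rewrite (isog_abelem_card H abG) oH cardsT oG eqxx andbT.
apply: abelemS (subsetT H) _; rewrite abelemE // (p2group_abelian pZ) ?oZ //.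
by apply/exponentP => g _; apply: eZ.
Qed.

(** * Spectra and traces of matrices *)

Lemma rank1_proportional (L : fieldType) m n (U : 'M[L]_(m, n)) (v w : 'rV_n) :
  \rank U = 1%N -> v != 0 -> (v <= U)%MS -> (w <= U)%MS -> exists c, w = c *: v.
Proof.
move=> r1 v0 vU wU; apply/sub_rVP; apply: submx_trans wU _.
by have /mxrank_leqif_sup/geq_leqif <- := vU; rewrite r1 rank_rV v0.
Qed.

(** k is a primitive cube root of unity, so the three eigenvalues are distinct and
    their elementary symmetric functions of degrees 1 and 2 vanish. *)
Lemma char_poly_three_eigenvalues (L : fieldType) (M : 'M[L]_3) (k x : L) :
  k ^+ 3 = 1 -> k != 1 -> x != 0 ->
  eigenvalue M x -> eigenvalue M (k * x) -> eigenvalue M (k * (k * x)) ->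
  char_poly M = 'X^3 - (x ^+ 3)%:P.
Proof.
move=> k3 k1 x0 e0 e1 e2.
have k0 : k != 0 by apply: contra_eq_neq k3 => ->; rewrite expr0n eq_sym oner_eq0.
have kk1 : k * k != 1.
  by apply: contraNneq k1 => h; rewrite -k3 !exprS expr0 mulr1 h mulr1.
have := @all_roots_prod_XsubC _ (char_poly M) [:: x; k * x; k * (k * x)].
rewrite size_char_poly (monicP (char_poly_monic M)) scale1r => -> //; last first.
- rewrite uniq_rootsE /= !inE andbT.
  have n1 : x != k * x by rewrite -{1}[x]mul1r (inj_eq (mulIf x0)) eq_sym.
  have n2 : x != k * (k * x) by rewrite -{1}[x]mul1r mulrA (inj_eq (mulIf x0)) eq_sym.
  by rewrite (inj_eq (mulfI k0)) (negPf n1) (negPf n2).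
- by rewrite /= -!eigenvalue_root_char e0 e1 e2.
rewrite !big_cons big_nil mulr1.
have s0 : 1 + k + k * k = 0.
  have : (k - 1) * (1 + k + k * k) = k ^+ 3 - 1 by ring.
  by rewrite k3 subrr => /eqP; rewrite mulf_eq0 subr_eq0 (negPf k1) => /eqP.
have s0' : 1 + k%:P + k%:P * k%:P = 0 by rewrite -polyCM -polyCD -polyCD s0.
rewrite rmorphXn /= !polyCM; move: k%:P x%:P s0' => c y e.
(* The difference of the two sides is a multiple of e. *)
rewrite -[RHS]addr0 -(mul0r (- 'X * 'X * y + c * 'X * y * y - (c - 1) * y * y * y)).
by rewrite -e; ring.
Qed.

Lemma char_poly_trace_cube (L : fieldType) (M : 'M[L]_3) x :
  char_poly M = 'X^3 - x%:P -> \tr M = 0 /\ M ^+ 3 = x%:M.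
Proof.
move=> e; split.
  apply/eqP; rewrite -oppr_eq0 -char_poly_trace // e.
  by rewrite coefB coefXn coefC subr0.
have := Cayley_Hamilton M; rewrite e rmorphB rmorphXn /= horner_mx_X horner_mx_C.
by move/eqP; rewrite subr_eq0 => /eqP.
Qed.

(** Matrices orthogonal for the pairing tr (M * N) are linearly independent. *)
Lemma trace_orthogonal_card (L : fieldType) n (I : finType) (M N : I -> 'M[L]_n) :
  (forall i k, i != k -> \tr (M i *m N k) = 0) ->
  (forall i, \tr (M i *m N i) != 0) -> (#|I| <= n * n)%N.
Proof.
move=> off diag.
pose A := \matrix_(i < #|I|) mxvec (M (enum_val i)).
suff /eqP <- : row_free A by apply: rank_leq_col.
apply: inj_row_free => v vA; apply/rowP => k; rewrite [RHS]mxE.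
have sum0 : \sum_i v 0 i *: M (enum_val i) = 0.
  apply: (can_inj mxvecK); rewrite linear0 -vA mulmx_sum_row linear_sum.
  by apply: eq_bigr => i _; rewrite linearZ rowK.
have := congr1 (fun B => \tr (B *m N (enum_val k))) sum0.
rewrite mul0mx mxtrace0 mulmx_suml raddf_sum (bigD1 k) //= big1 => [|i ik].
  rewrite addr0 -scalemxAl mxtraceZ => /eqP.
  by rewrite mulf_eq0 (negPf (diag _)) orbF => /eqP.
by rewrite -scalemxAl mxtraceZ off ?mulr0 // (inj_eq enum_val_inj).
Qed.

(** * Automorphisms of a non-split surface *)

Section BaseChange.
Variables (K L : fieldType) (j : {rmorphism K -> L}).
Implicit Types X Y : projvar K.

Lemma base_change_eqs X (x : pspace L (pv_dim X)) :
  all (fun p => peval (idfun : {rmorphism L -> L}) p (hcoord x) == 0)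
      (pv_eqs (base_change j X)) =
  all (fun p => peval j p (hcoord x) == 0) (pv_eqs X).
Proof.
rewrite all_map; apply: eq_all => p /=; congr (_ == _); rewrite /peval.
by congr (_.@[_]); apply/mpolyP => m; rewrite mcoeff_map_mpoly.
Qed.

Definition to_base X (x : gpoint j X) :
    gpoint (idfun : {rmorphism L -> L}) (base_change j X) :=
  exist _ (val x) (etrans (base_change_eqs (val x)) (valP x)).

Definition of_base X (x : gpoint (idfun : {rmorphism L -> L}) (base_change j X)) :
    gpoint j X :=
  exist _ (val x) (etrans (esym (base_change_eqs (val x))) (valP x)).

Lemma to_baseK X : cancel (@to_base X) (@of_base X).
Proof. by move=> x; apply: val_inj. Qed.

Lemma of_baseK X : cancel (@of_base X) (@to_base X).
Proof. by move=> x; apply: val_inj. Qed.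

Lemma lregular_of_base X Y
    (f : gpoint (idfun : {rmorphism L -> L}) (base_change j X) ->
         gpoint (idfun : {rmorphism L -> L}) (base_change j Y)) :
  regular f -> lregular (fun x => of_base (f (to_base x))).
Proof.
move=> /regular_lregular rf x v vx.
have [d [F [hF Fv Fy]]] := rf (to_base x) v vx; exists d, F; split=> // y w wy.
exact: Fy (to_base y) w wy.
Qed.

(** The points of a variety over K and those of its base change to L are the same
    points of projective space, so a geometric isomorphism can be read on the
    former, on which the Galois group acts. *)
Lemma geometric_iso X n :
  isomorphic (idfun : {rmorphism L -> L}) (base_change j X) (pn L n) ->
  exists (phi : gpoint j X -> gpoint j (pn K n)) psi,
    [/\ lregular phi, lregular psi, cancel phi psi & cancel psi phi].
Proof.
case=> f [f_reg [g [g_reg fK gK]]].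
exists (fun x => @of_base (pn K n) (f (to_base x))), (fun x => of_base (g (@to_base (pn K n) x))).
split.
- exact: (@lregular_of_base X (pn K n)).
- exact: (@lregular_of_base (pn K n) X).
- move=> x; rewrite [to_base (of_base _)]of_baseK.
  by rewrite fK to_baseK.
move=> x; rewrite of_baseK.
by rewrite gK; apply: to_baseK.
Qed.

End BaseChange.

Section Surface.
Variables (K : fieldType) (L : closedFieldType) (j : {rmorphism K -> L}).
Hypothesis algL : algebraic_closure j.
Hypothesis char0 : [pchar K] =i pred0.
Hypothesis roots1 : contains_all_roots_of_unity j.
Variable X : projvar K.
Variables (phi : gpoint j X -> gpoint j (pn K 2)) (psi : gpoint j (pn K 2) -> gpoint j X).
Hypotheses (phi_reg : lregular phi) (psi_reg : lregular psi).
Hypotheses (phiK : cancel phi psi) (psiK : cancel psi phi).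
Hypothesis nonsplit : ~ isomorphic j X (pn K 2).

Local Notation prp := (@rep K L j (pn K 2)).
Local Notation twist_mx := (@twisting K L j 1 X phi psi).

(** M is a matrix of g, transported to the projective plane by phi. *)
Definition represents (g : gpoint j X -> gpoint j X) (M : 'M[L]_3) :=
  M \in unitmx /\ forall v x, prp v x -> prp (v *m M) (phi (g (psi x))).

(** An invariant line of L^3 is a fixed point of the Galois action, and X would be
    split. *)
Lemma no_invariant_line (v : 'rV[L]_3) : v != 0 ->
  ~ (forall s C, twist_mx s C -> exists c, map_mx s v *m C = c *: v).
Proof.
move=> v0 vC; have [x vx] := rep_pn j v0; apply: nonsplit.
apply: (rational_point_split algL char0 phi_reg psi_reg phiK psiK (p0 := psi x)) => s.
have [C tC] := ex_twisting phi_reg psi_reg phiK psiK s; have [c e] := vC s C tC.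
have r := tC.2 _ _ vx; rewrite e in r.
apply: (can_inj phiK); rewrite psiK; apply: (rep_inj r).
apply: (@rep_scale _ _ j (pn K 2)) => //.
by apply: contraNneq r.1 => ->; rewrite scale0r.
Qed.

Lemma ex_represents g g' : regular g -> regular g' -> cancel g g' ->
  exists2 M, represents g M & \det M = 1.
Proof.
move=> g_reg g'_reg gK.
have [|||M uM hM] := @automorphism_pn_linear K L j 1 (phi \o g \o psi) (phi \o g' \o psi).
- apply: lregular_comp psi_reg (lregular_comp (regular_lregular g_reg) phi_reg).
- apply: lregular_comp psi_reg (lregular_comp (regular_lregular g'_reg) phi_reg).
- by move=> x; rewrite /= phiK gK psiK.
have dM : \det M != 0 by rewrite -unitfE -unitmxE.
have [c ec] : exists c, c ^+ 3 = \det M.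
  have [|c] := closed_rootP ('X^3 - (\det M)%:P : {poly L}) _.
    by rewrite size_XnsubC.
  by rewrite rootE !hornerE subr_eq0 => /eqP e; exists c.
have c0 : c != 0 by apply: contraNneq dM => h; rewrite -ec h expr0n.
exists (c^-1 *: M); last by rewrite detZ exprVn ec mulVf.
split; first by rewrite unitmxZ // unitfE invr_neq0.
move=> v x vx; rewrite -scalemxAr; apply: (@rep_scale _ _ j (pn K 2)); rewrite ?invr_neq0 //.
exact: hM.
Qed.

Lemma represents_proportional g M N :
  represents g M -> represents g N -> exists2 c, c != 0 & M = c *: N.
Proof.
move=> [uM hM] [uN hN]; have [o|c e] := frame_proportional uN (A := M).
  have [x ox] := rep_pn j (frame_neq0 L o).
  by have [c _ e] := rep_prop (hN _ _ ox) (hM _ _ ox); exists c.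
exists c => //; apply: contraTneq uM => c0.
by rewrite e c0 scale0r unitmxE det0 unitr0.
Qed.

Lemma represents_comp g h M N :
  represents g M -> represents h N -> represents (g \o h) (N *m M).
Proof.
move=> [uM hM] [uN hN]; split; first by rewrite unitmx_mul uN.
move=> v x vx; rewrite mulmxA.
by have := hM _ _ (hN _ _ vx); rewrite phiK.
Qed.

Lemma represents_id : represents id 1%:M.
Proof. by split=> [|v x vx]; rewrite ?unitmx1 // mulmx1 psiK. Qed.

Lemma represents_scalar g c : represents g c%:M -> g =1 id.
Proof.
move=> [_ hg] p; apply: (can_inj phiK).
have vx := rep_hcoord (phi p); have := hg _ _ vx; rewrite phiK mul_mx_scalar => r.
apply: (rep_inj r); apply: (@rep_scale _ _ j (pn K 2)) => //.
by apply: contraNneq r.1 => ->; rewrite scale0r.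
Qed.

(** The automorphism g is defined over K, so it commutes with the Galois action; on
    matrices the equality holds up to a scalar. *)
Lemma twist_commutes g M s C : regular g -> represents g M -> twist_mx s C ->
  exists k, C *m M = k *: (map_mx s M *m C).
Proof.
move=> g_reg [uM hM] [uC hC]; apply: frame_proportional => [|o].
  by rewrite unitmx_mul map_unitmx uM.
have [x ox] := rep_pn j (frame_neq0 L o).
have r1 := hM _ _ (hC _ _ ox); have r2 := hC _ _ (hM _ _ ox).
rewrite phiK regular_equivariant // in r1; rewrite phiK in r2.
have [c _ e] := rep_prop r2 r1; exists c.
by move: e; rewrite map_mxM map_frame !mulmxA.
Qed.

Lemma root_of_unity_fixed (s : gal j) n x : (0 < n)%N -> x ^+ n = 1 -> s x = x.
Proof. by move=> n0 /(roots1 n0)[a <-]; apply: gal_fix. Qed.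

Section Spectrum.
Variables (g : gpoint j X -> gpoint j X) (M : 'M[L]_3) (n : nat) (c : L).
Hypotheses (g_reg : regular g) (gM : represents g M) (dM : \det M = 1).
Hypotheses (n_gt0 : (0 < n)%N) (Mn : M ^+ n = c%:M).

(** By the determinant condition the scalar c is a cube root of unity, so x is a
    root of unity and lies in K. *)
Lemma eigenvalue_fixed x (s : gal j) : eigenvalue M x -> s x = x.
Proof.
case/eigenvalueP => v vM v0; apply: (@root_of_unity_fixed s (n * 3)).
  by rewrite muln_gt0 n_gt0.
have vMX i : v *m M ^+ i = x ^+ i *: v.
  elim: i => [|i IHi]; first by rewrite !expr0 mulmx1 scale1r.
  by rewrite exprSr -mulmxE mulmxA IHi -scalemxAl vM scalerA exprSr.
have -> : x ^+ (n * 3) = (x ^+ n) ^+ 3 by rewrite exprM.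
have -> : x ^+ n = c.
  have /eqP := vMX n; rewrite Mn mul_mx_scalar -subr_eq0 -scalerBl scaler_eq0.
  by rewrite (negPf v0) orbF subr_eq0 => /eqP.
rewrite -(det_scalar 3) -Mn.
by elim: (n) => [|i IHi]; rewrite ?expr0 ?det1 // exprS detM IHi dM mulr1.
Qed.

Lemma twist_cube_root s C k : twist_mx s C -> C *m M = k *: (map_mx s M *m C) ->
  k ^+ 3 = 1.
Proof.
move=> [uC _] /(congr1 determinant); rewrite detZ !det_mulmx det_map_mx dM rmorph1.
rewrite mulr1 mul1r -{1}[\det C]mul1r => e.
by apply/esym/(mulIf _ e); rewrite -unitfE -unitmxE.
Qed.

Lemma eigenvalue_twist s C k x : twist_mx s C -> C *m M = k *: (map_mx s M *m C) ->
  eigenvalue M x -> eigenvalue M (k * x).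
Proof.
move=> [uC _] e ex; have /eigenvalueP[v vM v0] := ex.
apply/eigenvalueP; exists (map_mx s v *m C); last first.
  by rewrite -(mul0mx _ C) (inj_eq (can_inj (mulmxK uC))) map_row_neq0.
rewrite -mulmxA e -scalemxAr mulmxA -map_mxM vM map_mxZ (eigenvalue_fixed s ex).
by rewrite -scalemxAl scalerA.
Qed.

(** Otherwise the kernel and the image of M - x, for an eigenvalue x, are invariant;
    their dimensions add up to 3 and neither is 0, so one of them is a line. *)
Lemma ex_nontrivial_twist : ~ (exists d, M = d%:M) ->
  exists s C k, [/\ twist_mx s C, C *m M = k *: (map_mx s M *m C) & k != 1].
Proof.
move=> nsc; apply: boolp.contrapT => triv.
have comm s C : twist_mx s C -> C *m M = map_mx s M *m C.
  move=> tC; have [k e] := twist_commutes g_reg gM tC.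
  have [k1|k1] := eqVneq k 1; first by rewrite e k1 scale1r.
  by case: triv; exists s, C, k.
have [x ex] : exists x, eigenvalue M x.
  have [|x rx] := closed_rootP (char_poly M) _; first by rewrite size_char_poly.
  by exists x; rewrite eigenvalue_root_char.
pose N := M - x%:M.
have commN s C : twist_mx s C -> C *m N = map_mx s N *m C.
  move=> tC; rewrite mulmxBr (comm s C tC) map_mxB mulmxBl map_scalar_mx.
  by rewrite /= (eigenvalue_fixed s ex) scalar_mxC.
have rN0 : \rank N != 0%N.
  by rewrite mxrank_eq0 subr_eq0; apply/eqP => h; apply: nsc; exists x.
have rN3 : (\rank N < 3)%N.
  rewrite ltn_neqAle rank_leq_row andbT -[_ == _]/(row_free N) -kermx_eq0.
  exact: ex.
have [r1|r2] : \rank N = 1%N \/ \rank N = 2%N.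
  by move: (\rank N) rN0 rN3 => [|[|[|]]] //; [left|right].
- have /rowV0Pn[v vN v0] : N != 0 by rewrite -mxrank_eq0 r1.
  apply: (no_invariant_line v0) => s C tC.
  apply: (rank1_proportional r1 v0 vN).
  case/submxP: vN => u ->; rewrite map_mxM -mulmxA -(commN s C tC) mulmxA.
  exact: submxMl.
have rk : \rank (kermx N) = 1%N by rewrite mxrank_ker r2.
have /rowV0Pn[v vN v0] : kermx N != 0 by rewrite -mxrank_eq0 rk.
apply: (no_invariant_line v0) => s C tC.
apply: (rank1_proportional rk v0 vN).
move/sub_kermxP: vN => vN; apply/sub_kermxP.
by rewrite -mulmxA (commN s C tC) mulmxA -map_mxM vN map_mx0 mul0mx.
Qed.

Lemma char_poly_nontrivial : ~ (exists d, M = d%:M) ->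
  exists x, char_poly M = 'X^3 - x%:P.
Proof.
case/ex_nontrivial_twist => s [C [k [tC e k1]]].
have [x ex] : exists x, eigenvalue M x.
  have [|x rx] := closed_rootP (char_poly M) _; first by rewrite size_char_poly.
  by exists x; rewrite eigenvalue_root_char.
exists (x ^+ 3); apply: (char_poly_three_eigenvalues (twist_cube_root tC e) k1) => //.
- apply: contraTneq ex => ->; apply/eigenvalueP => -[v].
  rewrite scale0r => /eqP; rewrite mulmx_free_eq0 ?row_free_unit ?gM.1 //.
  by move=> ->.
- exact: eigenvalue_twist e ex.
by do 2!apply: (eigenvalue_twist tC e).
Qed.

End Spectrum.

End Surface.

Theorem lemma4p6 (K : fieldType) (Kbar : closedFieldType)
    (j : {rmorphism K -> Kbar}) (hKbar : algebraic_closure j)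
    (char0 : [pchar K] =i pred0)
    (hroots : contains_all_roots_of_unity j)
    (S : projvar K) (hS : nontrivial_severi_brauer_surface j S)
    (gT : finGroupType) (rho : gT -> gpoint j S -> gpoint j S)
    (hG : finite_aut_group rho) :
  exists H : {group 'Z_3 * 'Z_3}, [set: gT]%G \isog H.
Proof.
have [phi [psi [phi_reg psi_reg phiK psiK]]] := geometric_iso hS.1.
have nonsplit : ~ isomorphic j S (pn K 2) := hS.2.
have [aut_rho rhoM rho_inj] := hG.
have rho_reg g : regular (rho g) by case: (aut_rho g).
have rho1 p : rho 1%g p = p.
  have [_ [f [_ rK _]]] := aut_rho 1%g; apply: (can_inj rK).
  by have /= <- := rhoM 1%g 1%g p; rewrite mulg1.
have [M hM] : exists M : gT -> 'M[Kbar]_3, forall g, represents phi psi (rho g) (M g) /\ \det (M g) = 1.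
  apply: (fin_all_exists (P := fun g M => represents phi psi (rho g) M /\ \det M = 1)) => g.
  have [_ [f [f_reg rK _]]] := aut_rho g.
  by have [M] := ex_represents phi_reg psi_reg phiK psiK (rho_reg g) f_reg rK; exists M.
have MM g h : exists2 c, c != 0 & M (g * h)%g = c *: (M h *m M g).
  apply: (represents_proportional (hM _).1).
  have [u r] := represents_comp phiK (hM g).1 (hM h).1; split=> // v x vx.
  by rewrite rhoM; apply: r.
have M1 : exists2 c, c != 0 & M 1%g = c%:M.
  have [|c c0 e] := represents_proportional (N := 1%:M) (hM 1%g).1.
    have [u r] := represents_id psiK; split=> // v x vx.
    by rewrite rho1; apply: r.
  by exists c; rewrite // e scalemx1.
have MX g n : exists2 c, c != 0 & M (g ^+ n)%g = c *: M g ^+ n.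
  elim: n => [|n [c c0 IHn]].
    by have [c c0 e] := M1; exists c; rewrite // expg0 e expr0 scalemx1.
  have [d d0 e] := MM g (g ^+ n)%g; exists (d * c); first exact: mulf_neq0.
  by rewrite expgS e IHn -scalemxAl scalerA exprSr.
have nonscalar g : g != 1%g -> ~ (exists d, M g = d%:M).
  move=> /eqP g1 [d e]; apply: g1; apply: rho_inj => p; rewrite rho1.
  by apply: (represents_scalar phiK (c := d)); rewrite -e; apply: (hM g).1.
have spectrum g : g != 1%g -> exists x, \tr (M g) = 0 /\ M g ^+ 3 = x%:M.
  move=> /nonscalar nsg; have [c c0 e] := MX g #[g]%g; have [d _ e1] := M1.
  have Mn : M g ^+ #[g]%g = (c^-1 * d)%:M.
    by rewrite -scale_scalar_mx -e1 -(expg_order g) e scalerK.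
  have [x ex] := char_poly_nontrivial hKbar char0 hroots phi_reg psi_reg phiK psiK
    nonsplit (rho_reg g) (hM g).1 (hM g).2 (order_gt0 g) Mn nsg.
  by exists x; apply: char_poly_trace_cube ex.
have exp3 (g : gT) : (g ^+ 3 = 1)%g.
  apply/eqP; apply/negPn/negP => g3; case: (nonscalar _ g3).
  have g1 : g != 1%g by apply: contraNneq g3 => ->; rewrite expg1n.
  have [x [_ e]] := spectrum g g1; have [c _ ->] := MX g 3%N.
  by exists (c * x); rewrite e scale_scalar_mx.
apply: small_exponent3_isog exp3 _.
(* M (g^-1 h) is proportional to the product of M h and M g^-1, and has trace 0
   unless g = h. *)
apply: (@trace_orthogonal_card Kbar 3 gT M (fun g => M g^-1%g)) => [g h gh|g].
  have [c c0 e] := MM h^-1%g g; have [|x [tr0 _]] := spectrum (h^-1 * g)%g.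
    by rewrite -eq_mulVg1 eq_sym.
  move: tr0; rewrite e mxtraceZ => /eqP; rewrite mulf_eq0 (negPf c0) => /eqP.
  exact.
have [c c0 e] := MM g^-1%g g; have [d d0 e1] := M1.
have : \tr (M (g^-1 * g)%g) != 0.
  rewrite mulVg e1 mxtrace_scalar -mulr_natr mulf_neq0 //.
  by rewrite -(rmorph_nat j) fmorph_eq0; move/pcharf0P: char0 => ->.
by rewrite e mxtraceZ mulf_eq0 negb_or => /andP[].
Qed.
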